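(* Let $d,n\in\mathbb N$. For every partition $\lambda\vdash d$ with $\ell(\lambda)\le n$, let $\pi_\lambda\colon\mathcal U_n\to\mathcal U(S_\lambda(\mathbb C^n))$ denote the corresponding irreducible unitary representation. Then $$\mathcal P_d(\mathcal U_n)=\bigoplus_{\substack{\lambda\vdash d\\\ell(\lambda)\le n}}\mathcal E_{\pi_\lambda^*}(\mathcal U_n)$$ orthogonally in $L_2(\mathcal U_n)$. Equivalently, under the biregular action of $\mathcal U_n\times\mathcal U_n$, the space $\mathcal P_d(\mathcal U_n)$ is the multiplicity-free direct sum of the irreducible representation types $\pi_\lambda^*\boxtimes\pi_\lambda$, where $\lambda\vdash d$ and $\ell(\lambda)\le n$.
   Context: Complex scalars; inner products are linear in the first variable. $\mathcal U_n$ is the unitary group of $\mathbb C^n$ with normalized Haar measure, and $L_2(\mathcal U_n)$ is taken with respect to it. $\mathcal P_d(\mathcal U_n)\subset C(\mathcal U_n)$ is the space of restrictions to $\mathcal U_n$ of complex $d$-homogeneous (holomorphic) polynomials on the space $\mathcal L(\mathbb C^n)$ of complex $n\times n$ matrices. A partition $\lambda\vdash d$ is a non-increasing sequence $\lambda_1\ge\lambda_2\ge\cdots$ of non-negative integers with sum $d$; $\ell(\lambda)$ is its number of non-zero parts. For $\ell(\lambda)\le n$, the Schur polynomial is $s_\lambda(x_1,\ldots,x_n)=\det(x_i^{\lambda_j+n-j})_{i,j}/\det(x_i^{n-j})_{i,j}$ (extended to a polynomial), and $\pi_\lambda$ is the irreducible unitary representation of $\mathcal U_n$, unique up to equivalence,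 on a space denoted $S_\lambda(\mathbb C^n)$, whose character is $g\mapsto s_\lambda(\operatorname{eigs}(g))$, with $\operatorname{eigs}(g)$ the eigenvalues of $g$. For a finite-dimensional unitary representation $\pi$ on $V_\pi$, $\pi^*$ is the contragredient representation on $V_\pi^*$, $(\pi^*(g)\varphi)(v)=\varphi(\pi(g^{-1})v)$. For irreducible $\pi$, $\mathcal E_\pi(\mathcal U_n)=\operatorname{span}\{x\mapsto\langle v,\pi(x)u\rangle:u,v\in V_\pi\}\subset C(\mathcal U_n)$. The biregular action on functions is $((g,h)\bullet f)(x)=f(g^{-1}xh)$. For representations $\pi,\sigma$ of $\mathcal U_n$, $\pi\boxtimes\sigma$ is the representation of $\mathcal U_n\times\mathcal U_n$ on $V_\pi\otimes V_\sigma$ given by $(g,h)\mapsto\pi(g)\otimes\sigma(h)$. *)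

(* Defs.v *)
From HB Require Import structures.
(* mpoly has to be imported before the analysis library: their notations clash
   in the other order. *)
From mathcomp Require Import all_boot all_order all_algebra.
From mathcomp Require Import perm mpoly.
From mathcomp Require Import all_classical all_reals all_analysis.
From mathcomp Require Import complex mxtens.

Set Implicit Arguments.
Unset Strict Implicit.
Unset Printing Implicit Defensive.

Import Order.TTheory GRing.Theory Num.Theory.
Import numFieldNormedType.Exports.

Local Open Scope classical_set_scope.
Local Open Scope ring_scope.

HB.instance Definition _ (R : rcfType) := NormedModule.copy R[i] R[i]^o.

Section UnitaryGroup.
Variables (R : rcfType) (n : nat).

Record unitaryG := UnitaryG {
  umx :> 'M[R[i]]_n;
  umxP : umx \is unitarymx }.

HB.instance Definition _ := [isSub for umx].
HB.instance Definition _ := [Choice of unitaryG by <:].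
HB.instance Definition _ :=
  Topological.copy unitaryG (@initial_topology unitaryG _ umx).

Lemma umx1P : (1%:M : 'M[R[i]]_n) \is unitarymx.
Proof. by apply/unitarymxP; rewrite trmx1 map_mx1 mulmx1. Qed.

Definition uone := UnitaryG umx1P.
Definition umul (x y : unitaryG) := UnitaryG (mul_unitarymx (umxP x) (umxP y)).

Lemma umxVP (x : unitaryG) : map_mx (@Num.conj R[i]) (umx x)^T \is unitarymx.
Proof. by rewrite trmxC_unitary umxP. Qed.

Definition uinv (x : unitaryG) := UnitaryG (umxVP x).

Lemma umulA : associative umul.
Proof. by move=> x y z; apply: val_inj; rewrite /= mulmxA. Qed.

Lemma umul1g : left_id uone umul.
Proof. by move=> x; apply: val_inj; rewrite /= mul1mx. Qed.

Lemma umulg1 : right_id uone umul.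
Proof. by move=> x; apply: val_inj; rewrite /= mulmx1. Qed.

Lemma umulgV : right_inverse uone uinv umul.
Proof. by move=> x; apply: val_inj => /=; apply/unitarymxP/umxP. Qed.

Lemma umulVg : left_inverse uone uinv umul.
Proof. by move=> x; apply: val_inj => /=; apply/mulmx1C/unitarymxP/umxP. Qed.

HB.instance Definition _ :=
  isGroup.Build unitaryG umulA umul1g umulg1 umulVg umulgV.
HB.instance Definition _ := isPointed.Build unitaryG uone.

End UnitaryGroup.

Notation borelU R n := (g_sigma_algebraType (@open (unitaryG R n))).

Definition is_haar (R : realType) (n : nat)
    (mu : probability (borelU R n) R) : Prop :=
  forall (g : unitaryG R n) (A : set (borelU R n)), measurable A ->
    mu ((fun x : unitaryG R n => (g * x)%g) @^-1` A) = mu A.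

Definition Cintegral (R : realType) (n : nat) (mu : probability (borelU R n) R)
    (f : unitaryG R n -> R[i]) : R[i] :=
  Complex (Rintegral mu setT (fun x => complex.Re (f x)))
          (Rintegral mu setT (fun x => complex.Im (f x))).

Definition L2dot (R : realType) (n : nat) (mu : probability (borelU R n) R)
    (f h : unitaryG R n -> R[i]) : R[i] :=
  Cintegral mu (fun x => f x * Num.conj (h x)).

Section LinearAlgebra.
Variables (K : fieldType) (V : lmodType K).

Definition lin_span (S : set V) : set V :=
  [set f | exists (m : nat) (a : 'I_m -> K) (e : 'I_m -> V),
     (forall i, S (e i)) /\ f = \sum_(i < m) a i *: e i].

Definition direct_sum (I : finType) (W : set V) (E : I -> set V) : Prop :=
  (forall f, W f <->
     exists e : I -> V, (forall i, E i (e i)) /\ f = \sum_i e i) /\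
  (forall e : I -> V, (forall i, E i (e i)) -> \sum_i e i = 0 ->
     forall i, e i = 0).

End LinearAlgebra.

Section MatrixRepresentations.
Variables (K : fieldType) (G : Type).

(* Matrices act on column vectors from the left. *)
Definition irreducible_rep (k : nat) (rho : G -> 'M[K]_k) : Prop :=
  (0 < k)%N /\
  forall W : {vspace 'cV[K]_k},
    (forall g v, v \in W -> rho g *m v \in W) -> W = 0%VS \/ W = fullv.

Definition equiv_rep (k l : nat) (rho : G -> 'M[K]_k) (sigma : G -> 'M[K]_l) :
    Prop :=
  exists (A : 'M[K]_(k, l)) (B : 'M[K]_(l, k)),
    [/\ A *m B = 1%:M, B *m A = 1%:M & forall g, rho g *m A = A *m sigma g].

(* W is stable under act and (W, act) is equivalent to (K^k, rho). *)
Definition affords_rep (V : lmodType K) (act : G -> V -> V) (W : set V)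
    (k : nat) (rho : G -> 'M[K]_k) : Prop :=
  exists T : {linear 'cV[K]_k -> V},
    [/\ injective T, range T = W & forall g v, T (rho g *m v) = act g (T v)].

Definition multfree_sum (V : lmodType K) (act : G -> V -> V) (W : set V)
    (I : finType) (k : I -> nat) (rho : forall i, G -> 'M[K]_(k i)) : Prop :=
  exists E : I -> set V,
    [/\ direct_sum W E,
        forall i, irreducible_rep (rho i),
        forall i, affords_rep act (E i) (rho i) &
        forall i j, i != j -> ~ equiv_rep (rho i) (rho j)].

End MatrixRepresentations.

(* External tensor product: 'cV_k (x) 'cV_l is 'cV_(k * l), with v (x) w the
   Kronecker product. *)
Definition box_rep (K : fieldType) (G H : Type) (k l : nat)
    (rho : G -> 'M[K]_k) (sigma : H -> 'M[K]_l) : G * H -> 'M[K]_(k * l) :=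
  fun gh => rho gh.1 *t sigma gh.2.

Section Representations.
Variables (R : realType) (n : nat).
Local Notation C := R[i].
Local Notation U := (unitaryG R n).

(* The representation space is C^(udim) with its standard inner product, i.e.
   an orthonormal basis of the representation space is fixed. *)
Record unitary_rep := UnitaryRep {
  udim : nat;
  urep :> U -> unitaryG R udim;
  urep_morph : {morph urep : g h / (g * h)%g};
  urep_continuous : continuous urep }.

Definition rep_mx (rho : unitary_rep) : U -> 'M[C]_(udim rho) :=
  fun g => umx (rho g).

(* (pi^*(g) phi)(v) = phi (pi(g^-1) v): a functional phi is a row vector, on
   which pi^*(g) acts as phi |-> phi *m pi(g^-1); the transpose is the matrix of
   pi^*(g) in the dual basis. *)
Definition contragredient (k : nat) (rho : U -> 'M[C]_k) : U -> 'M[C]_k :=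
  fun g => (rho (g^-1)%g)^T.

Definition Cdot (k : nat) (v w : 'cV[C]_k) : C :=
  \sum_(i < k) v i 0 * Num.conj (w i 0).

Definition coeff_space (k : nat) (rho : U -> 'M[C]_k) : set (U -> C) :=
  lin_span [set f | exists u v : 'cV[C]_k, f = fun x => Cdot v (rho x *m u)].

Definition hom_poly_space (d : nat) : set (U -> C) :=
  [set f | exists2 p : {mpoly C[n * n]}, p \is d.-homog &
     f = fun x => p.@[fun i => mxvec (umx x) 0 i]].

Definition biregular (gh : U * U) (f : U -> C) : U -> C :=
  fun x => f (gh.1^-1 * x * gh.2)%g.

End Representations.

(* A partition is the list of its non-zero parts; its length is the size. *)
Definition is_intpart (d : nat) (l : seq nat) : bool :=
  [&& sorted geq l, 0%N \notin l & sumn l == d].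

Record intpart (d n : nat) := IntPart {
  parts :> seq nat;
  _ : is_intpart d parts && (size parts <= n)%N }.

Section IntPartFinite.
Variables d n : nat.

HB.instance Definition _ := [isSub for @parts d n].
HB.instance Definition _ := [Countable of intpart d n by <:].

Definition intpart_code (l : intpart d n) : {bseq n of 'I_d.+1} :=
  insub_bseq n [seq inord m | m <- parts l].

Definition intpart_decode (s : {bseq n of 'I_d.+1}) : option (intpart d n) :=
  insub [seq nat_of_ord i | i <- s].

Lemma intpart_codeK : pcancel intpart_code intpart_decode.
Proof.
move=> l; rewrite /intpart_decode /intpart_code.
have /andP[/and3P[_ _ /eqP dl] nl] := valP l.
rewrite -[X in map _ X]/(val _) val_insubd size_map nl -map_comp.
rewrite map_id_in ?valK // => m ml /=; rewrite inordK // ltnS -dl /=.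
elim: (parts l) ml => //= a s IH; rewrite inE => /orP[/eqP->|/IH ms].
  exact: leq_addr.
exact: leq_trans ms (leq_addl _ _).
Qed.

HB.instance Definition _ : fintype.isFinite (intpart d n) :=
  PCanIsFinite intpart_codeK.

End IntPartFinite.

Local Notation tofrac := (@FracField.tofrac _).

Lemma det_pow_dvd (A : comNzRingType) (n : nat) (x : 'I_n -> A)
    (e : 'I_n -> nat) :
  exists s, \det (\matrix_(i < n, j < n) x i ^+ e j) =
            s * \det (\matrix_(i < n, j < n) x i ^+ (n - j.+1)).
Proof.
pose Q : {poly A} := \prod_(i < n) ('X - (x i)%:P).
have Qmon : Q \is monic by exact: monic_prod_XsubC.
have szQ : size Q = n.+1 by rewrite /Q -big_enum size_prod_XsubC size_enum_ord.
have Qx i : Q.[x i] = 0.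
  by rewrite /Q horner_prod (bigD1 i) //= hornerXsubC subrr mul0r.
pose r j := Pdiv.Ring.rmodp 'X^(e j) Q.
exists (\det (\matrix_(k < n, j < n) (r j)`_(n - k.+1))).
rewrite [RHS]mulrC -det_mulmx; congr (\det _).
apply/matrixP => i j; rewrite !mxE.
have -> : x i ^+ e j = (r j).[x i].
  rewrite -[LHS]hornerXn [X in X.[_]](Pdiv.RingMonic.rdivp_eq Qmon).
  by rewrite hornerD hornerM Qx mulr0 add0r.
have szr : (size (r j) <= n)%N.
  by rewrite -ltnS -szQ Pdiv.Ring.ltn_rmodpN0 // monic_neq0.
rewrite (horner_coef_wide _ szr) (reindex_inj rev_ord_inj) /=.
by apply: eq_bigr => k _; rewrite !mxE mulrC.
Qed.

Section Schur.
Variables (K : fieldType) (n : nat).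

(* Indices start at 0, so the exponent written n - j for j = 1, ..., n is
   n - j.+1 for j < n. *)
Definition alternant (l : seq nat) : {mpoly K[n]} :=
  \det (\matrix_(i < n, j < n) 'X_i ^+ (nth 0 l j + (n - j.+1))%N).

Definition schur (l : seq nat) : {mpoly K[n]} :=
  xget 0 [set s : {mpoly K[n]} |
    tofrac s = tofrac (alternant l) / tofrac (alternant [::])].

Lemma alternant_dvd (l : seq nat) :
  exists s, alternant l = s * alternant [::].
Proof.
have [s sE] := @det_pow_dvd {mpoly K[n]} n (fun i => 'X_i)
  (fun j => nth 0 l j + (n - j.+1))%N.
exists s; rewrite [LHS]sE; congr (_ * \det _); apply/matrixP => i j.
by rewrite !mxE nth_nil add0n.
Qed.

Lemma alternant0_neq0 : alternant [::] != 0.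
Proof.
pose V := Vandermonde n (\row_(i < n) ('X_i : {mpoly K[n]})).
have -> : alternant [::] = \det (row_perm (perm rev_ord_inj) V)^T.
  congr (\det _); apply/matrixP => i j.
  by rewrite !mxE permE nth_nil add0n.
rewrite det_tr row_permE det_mulmx det_perm mulf_neq0 ?signr_eq0 //.
rewrite det_Vandermonde; apply/prodf_neq0 => i _; apply/prodf_neq0 => j ij.
rewrite !mxE subr_eq0; apply: contraTneq ij => /(congr1 (mcoeff U_(i))).
rewrite !mcoeffXU eqxx; case: eqVneq => [-> | _ /eqP]; first by rewrite ltnn.
by rewrite eq_sym oner_eq0.
Qed.

Lemma schurE (l : seq nat) : schur l * alternant [::] = alternant l.
Proof.
have [s sE] := alternant_dvd l.
have nz : tofrac (alternant [::]) != 0 by rewrite tofrac_eq0 alternant0_neq0.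
have : exists s, tofrac s = tofrac (alternant l) / tofrac (alternant [::]).
  by exists s; rewrite sE tofracM mulfK.
move=> /(@xgetPex _ 0) /= h; apply/eqP; rewrite -tofrac_eq tofracM.
by rewrite [tofrac (schur l)]h divfK.
Qed.

End Schur.

Definition is_eigs (R : realType) (n : nat) (g : 'M[R[i]]_n)
    (x : 'I_n -> R[i]) : Prop :=
  char_poly g = \prod_(i < n) ('X - (x i)%:P).

Definition is_schur_rep (R : realType) (n : nat) (l : seq nat)
    (rho : unitary_rep R n) : Prop :=
  irreducible_rep (rep_mx rho) /\
  forall (g : unitaryG R n) (x : 'I_n -> R[i]), is_eigs (umx g) x ->
    \tr (rep_mx rho g) = (schur R[i] n l).@[x].

(* Main.v *)
(** Two families of functions on [U_n] have the same kernel: the degree [d]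
    monomials [M_e] in the matrix entries satisfy
    [\sum_e (M_e x)^* * M_e y = (\tr (x^-1 * y)) ^+ d], and since
    [(x_1 + ... + x_n) ^+ d = \sum_l s_l *+ m_l] with all [m_l > 0] (Pieri's
    rule for a single box), this is also the sum of
    [m_l * \tr (pi_l (x^-1 * y))], i.e. of the
    [m_l * (pi_l x i j)^* * pi_l y i j]. For a combination of point evaluations
    [\sum_k c_k f(x_k)], the kernel gives the (weighted) sum of the squared
    norms of its values on the family, so both families are annihilated by the
    same combinations and have the same span: [P_d] is spanned by the entries of
    the [pi_l]. These entries are the coefficients of the [pi_l^*], as [pi_l^*]
    is the entrywise conjugate of [pi_l]. Schur's orthogonality relations, by
    averaging over Haar measure, give orthogonality and linear independence;
    distinct [l] yield inequivalent [pi_l] because Schur polynomials are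
    determined by their values on the torus. Finally a representation whose
    matrix entries are linearly independent is irreducible, which applies to
    the external tensor products. *)
From HB Require Import structures.
Require Import Defs.
From mathcomp Require Import all_boot all_order all_algebra.
From mathcomp Require Import perm mpoly.
From mathcomp Require Import all_classical all_reals all_analysis.
From mathcomp Require Import complex mxtens.
From mathcomp Require Import measurable_realfun ring.
Import Order.TTheory GRing.Theory Num.Theory.
Import numFieldNormedType.Exports.
Local Open Scope ring_scope.

Set Implicit Arguments.
Unset Strict Implicit.
Unset Printing Implicit Defensive.

(** * Spans and kernels of finite families of functions *)

(** At most [m] points can have linearly independent rows of values of [g]. For a largest such set,
    the row of any further point [y] is a combination of the chosen rows; the hypothesis carries
    this relation over to [f], so [f] is determined by its values at the chosen points. *)
Lemma span_of_vanishing (K : fieldType) (X : Type) (m : nat)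
    (g : 'I_m -> X -> K) (f : X -> K) :
  (forall r (c : 'I_r -> K) (x : 'I_r -> X),
     (forall j, \sum_k c k * g j (x k) = 0) -> \sum_k c k * f (x k) = 0) ->
  exists v : 'I_m -> K, forall x, f x = \sum_j v j * g j x.
Proof.
move=> fg.
pose M r (x : 'I_r -> X) := \matrix_(i < r, j < m) g j (x i).
pose P r := `[< exists x : 'I_r -> X, row_free (M r x) >].
have P0 : exists r, P r.
  exists 0%N; apply/asboolP.
  exists (fun i : 'I_0 => match notF (valP i) with end).
  by rewrite /row_free -leqn0 rank_leq_row.
have Pm r : P r -> (r <= m)%N.
  by move=> /asboolP[x /eqP <-]; exact: rank_leq_col.
case: (ex_maxnP P0 Pm) => r /asboolP[x xfree] rmax.
(* The coefficients solve the linear system at the chosen points only; the system is solvable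
   because its matrix is row-free. *)
exists (fun j => (pinvmx (M r x) *m \col_k f (x k)) j 0) => y.
pose x' (i : 'I_r.+1) := if unlift ord0 i is Some k then x k else y.
have x'0 : x' ord0 = y by rewrite /x' unlift_none.
have x'S k : x' (lift ord0 k) = x k by rewrite /x' liftK.
have /submxP[c yE] : ((\row_j g j y) <= M r x)%MS.
  apply: contraT => yM.
  suff /rmax : P r.+1 by rewrite ltnn.
  apply/asboolP; exists x'; rewrite /row_free eqn_leq rank_leq_row /=.
  rewrite -[X in (X < _)%N](eqP xfree).
  apply: (@leq_trans (\rank (M r x + (\row_j g j y)%R))%MS); last first.
    apply: mxrankS; rewrite addsmx_sub; apply/andP; split.
      apply/row_subP => i.
      have -> : row i (M r x) = row (lift ord0 i) (M r.+1 x').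
        by apply/rowP => j; rewrite !mxE x'S.
      exact: row_sub.
    have -> : \row_j g j y = row ord0 (M r.+1 x').
      by apply/rowP => j; rewrite !mxE x'0.
    exact: row_sub.
  apply: rank_ltmx; rewrite /ltmx addsmxSl /=.
  by apply: contra yM => h; apply: submx_trans h; exact: addsmxSr.
have yj j : g j y = \sum_k c 0 k * g j (x k).
  have := congr1 (fun A : 'rV[K]_m => A 0 j) yE; rewrite !mxE => ->.
  by apply: eq_bigr => k _; rewrite mxE.
have fy : f y = \sum_k c 0 k * f (x k).
  (* The relation for [y] is brought to one side, which gives [y] the weight -1. *)
  pose c' (i : 'I_r.+1) := if unlift ord0 i is Some k then c 0 k else -1.
  have c'S k : c' (lift ord0 k) = c 0 k by rewrite /c' liftK.
  have sumE (h : X -> K) : \sum_k c' k * h (x' k) =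
      - h y + \sum_k c 0 k * h (x k).
    rewrite big_ord_recl x'0 /c' unlift_none mulN1r; congr (_ + _).
    by apply: eq_bigr => k _; rewrite liftK x'S.
  have := fg r.+1 c' x'; rewrite sumE addrC => h.
  by apply/esym/subr0_eq/h => j; rewrite sumE yj addNr.
have Mv : M r x *m (pinvmx (M r x) *m \col_k f (x k)) = \col_k f (x k).
  by rewrite mulmxA mulmxVp // mul1mx.
rewrite fy; transitivity ((c *m (\col_k f (x k))) 0 0).
  by rewrite mxE; apply: eq_bigr => k _; rewrite mxE.
rewrite -[in LHS]Mv mulmxA -yE mxE; apply: eq_bigr => j _.
by rewrite [X in X * _]mxE mulrC.
Qed.

(* For every combination of point evaluations,
   [\sum_i a i * `|\sum_k c k * f i (x k)| ^+ 2] depends only on the kernel. *)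
Lemma same_kernel_span (C : numClosedFieldType) (X : Type) (I J : finType)
    (f : I -> X -> C) (g : J -> X -> C) (a : I -> C) (b : J -> C) :
  (forall i, 0 < a i) ->
  (forall x y, \sum_i a i * ((f i x)^* * f i y) =
               \sum_j b j * ((g j x)^* * g j y)) ->
  forall i, exists v : J -> C, forall x, f i x = \sum_j v j * g j x.
Proof.
move=> a_gt0 fg i.
have sq (L : finType) (h : L -> X -> C) (u : L -> C) r (c : 'I_r -> C)
    (x : 'I_r -> X) :
    \sum_l u l * `|\sum_k c k * h l (x k)| ^+ 2 =
    \sum_k \sum_k' (c k)^* * c k' *
      (\sum_l u l * ((h l (x k))^* * h l (x k'))).
  under [RHS]eq_bigr do under eq_bigr do rewrite mulr_sumr.
  under [RHS]eq_bigr do rewrite exchange_big.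
  rewrite exchange_big; apply: eq_bigr => l _ /=.
  rewrite normCKC rmorph_sum mulr_suml mulr_sumr; apply: eq_bigr => k _.
  rewrite mulr_sumr mulr_sumr; apply: eq_bigr => k' _.
  by rewrite rmorphM /=; ring.
have [r c x gx|v vE] := @span_of_vanishing C X #|J|
    (fun j => g (enum_val j)) (f i).
  have : \sum_i a i * `|\sum_k c k * f i (x k)| ^+ 2 = 0.
    rewrite sq; under eq_bigr do under eq_bigr do rewrite fg.
    rewrite -sq big1 // => j _.
    have := gx (enum_rank j); rewrite enum_rankK => ->.
    by rewrite normr0 expr0n mulr0.
  move=> /psumr_eq0P h; apply/eqP; rewrite -normr_eq0 -sqrf_eq0; apply/eqP.
  have /h/(_ i isT) : forall i, true ->
      0 <= a i * `|\sum_k c k * f i (x k)| ^+ 2.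
    by move=> j _; rewrite mulr_ge0 ?exprn_ge0 // ltW.
  by move/eqP; rewrite mulf_eq0 gt_eqF ?a_gt0 //= => /eqP.
exists (fun j => v (enum_rank j)) => x; rewrite vE.
rewrite (reindex enum_rank); last by apply: onW_bij; exact: enum_rank_bij.
by apply: eq_bigr => j _; rewrite enum_rankK.
Qed.

(** * Pieri's rule for a single box and its iteration *)

(** In the Leibniz term of [s], a factor [x k] raises the exponent in column [s k]. Reindexing [k]
    by [s] names the raised column independently of [s]. *)
Lemma sum_mul_det_pow (A : comNzRingType) (n : nat) (x : 'I_n -> A)
    (e : 'I_n -> nat) :
  (\sum_i x i) * \det (\matrix_(i, j) x i ^+ e j) =
  \sum_k \det (\matrix_(i, j) x i ^+ (e j + (j == k))).
Proof.
rewrite /determinant mulr_sumr exchange_big; apply: eq_bigr => s _ /=.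
rewrite -mulr_sumr mulrCA; congr (_ * _).
rewrite [RHS](reindex_inj (@perm_inj _ s)) mulr_suml; apply: eq_bigr => k _ /=.
under [RHS]eq_bigr do rewrite mxE exprD.
rewrite big_split mulrC /=; congr (_ * _).
  by apply: eq_bigr => i _; rewrite mxE.
rewrite (bigD1 k) //= eqxx expr1 big1 ?mulr1 // => i ik.
by rewrite (inj_eq perm_inj) (negbTE ik).
Qed.

(** Row 0 can always grow. The default 0 of [nth] lets a new row start just below the last one, but
    no lower. *)
Definition addable (l : seq nat) (k : nat) : bool :=
  (k == 0)%N || (nth 0 l k < nth 0 l k.-1)%N.

(** Pieri's rule for one box, multiplied through by the Vandermonde determinant: raising the
    exponent of column [k] adds a box to row [k]. *)
Lemma sum_mul_alternant (K : fieldType) (n : nat) (l : seq nat) :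
  sorted geq l ->
  (\sum_(i < n) 'X_i) * alternant K n l =
  \sum_(k < n | addable l k) alternant K n (incr_nth l k).
Proof.
move=> sl; rewrite sum_mul_det_pow.
rewrite [LHS](bigID (fun k : 'I_n => addable l k)) /=.
(* At a position where no box can be added two columns coincide. *)
rewrite addrC big1 ?add0r => [|k].
  apply: eq_bigr => k _; congr (\det _); apply/matrixP => i j.
  by rewrite !mxE nth_incr_nth addnC addnA eq_sym.
rewrite negb_or -leqNgt => /andP[k0 lk].
have kn : (k.-1 < n)%N by apply: leq_ltn_trans (leq_pred _) (ltn_ord k).
have kk : Ordinal kn != k by rewrite -val_eqE /= ltn_eqF // prednK // lt0n.
have lkE : nth 0%N l k = nth 0%N l k.-1.
  apply/eqP; rewrite eqn_leq lk andbT.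
  have [ks|ks] := ltnP k (size l); last by rewrite nth_default.
  have kp : k = k.-1.+1 :> nat by rewrite prednK // lt0n.
  rewrite [X in (nth _ _ X <= _)%N]kp.
  by move/(sortedP 0%N) : sl; apply; rewrite -kp.
(* As rows [k.-1] and [k] have equal length, the extra box raises the exponent of column [k] to that
   of column [k.-1]. *)
rewrite -det_tr; apply: (determinant_alternate kk) => i.
rewrite !mxE (negbTE kk) eqxx addn0 lkE -addnA; congr ('X_i ^+ (_ + _))%N => /=.
have := ltn_ord k; case: (k : nat) k0 => // k' _ k'n /=.
by rewrite addn1 subnSK.
Qed.

Lemma intpart_incr (d n : nat) (l : intpart d n) (k : 'I_n) :
  addable l k ->
  is_intpart d.+1 (incr_nth l k) && (size (incr_nth l k) <= n)%N.
Proof.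
have /andP[/and3P[sl l0 /eqP dl] nl] := valP l; rewrite /= in sl l0 dl nl.
(* Below row [size l] both compared entries read the default 0, so no box can be added there. *)
move=> kl; have ks : (k <= size l)%N.
  case/orP: kl => [/eqP -> //|]; apply: contraLR; rewrite -ltnNge => sk.
  rewrite -leqNgt [X in (X <= _)%N]nth_default //.
  by rewrite -ltnS; apply: leq_trans sk (leqSpred _).
have sz : size (incr_nth l k) = maxn (size l) k.+1.
  rewrite size_incr_nth; case: ltnP => h; first by rewrite (maxn_idPl h).
  by rewrite (maxn_idPr _) // leqW.
have lnz i : (i < size l)%N -> (0 < nth 0 l i)%N.
  by move=> il; rewrite lt0n; apply: contraNneq l0 => <-; exact: mem_nth.
rewrite sz geq_max nl ltn_ord !andbT /is_intpart; apply/and3P; split.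
- apply/(sortedP 0%N) => i; rewrite sz !nth_incr_nth => il.
  have li : (nth 0 l i.+1 <= nth 0 l i)%N.
    have [i1|i1] := ltnP i.+1 (size l); last by rewrite nth_default.
    by move/(sortedP 0%N) : sl; apply.
  rewrite /geq /=; have [kE|ki] := eqVneq (k : nat) i.+1.
    move: kl; rewrite /addable kE /= => kl.
    by apply: leq_trans (leq_addl _ _).
  by rewrite add0n; apply: leq_trans li (leq_addl _ _).
- apply/(nthP 0%N) => -[] i; rewrite sz nth_incr_nth leq_max => /orP[/lnz il|].
    by move/eqP; rewrite addn_eq0 (gtn_eqF il) andbF.
  rewrite ltnS leq_eqVlt => /orP[/eqP -> |ik]; first by rewrite eqxx.
  have /lnz il := leq_trans ik ks.
  by move/eqP; rewrite addn_eq0 (gtn_eqF il) andbF.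
- suff -> : sumn (incr_nth l k) = (sumn l).+1 by rewrite dl.
  elim: (parts l) (k : nat) => [|a s IH] [|j] //=; last by rewrite IH addnS.
  by elim: j.
Qed.

(** A box can always be removed from the last row. This makes every partition reachable, hence every
    multiplicity below positive. *)
Lemma intpart_decr (d n : nat) (mu : intpart d.+1 n) :
  exists (l : intpart d n) (k : 'I_n), addable l k /\ incr_nth l k = mu.
Proof.
have /andP[/and3P[]] := valP mu; rewrite /=.
case/lastP: (parts mu) => [//|s a] ss.
rewrite mem_rcons inE negb_or sumn_rcons size_rcons => /andP[a0 s0] da sn.
case: a a0 ss da => // a _ ss; rewrite addnS eqSS => da.
pose k := Ordinal sn.
have ssa : sorted geq s /\ (0 < size s -> (a.+1 <= last 0 s))%N.
  by case: (s) ss => //= x t; rewrite rcons_path => /andP[-> ?].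
(* A last row of a single box has to disappear, since the list holds non-zero parts only. *)
case: a ss da ssa => [|a] ss da [s1 s2].
  have sP : is_intpart d s && (size s <= n)%N.
    by rewrite addn0 in da; rewrite /is_intpart s1 s0 da (ltnW sn).
  exists (IntPart sP), k; split.
    rewrite /addable /= nth_default //; case: (posnP (size s)) => //= h.
    by rewrite nth_last s2.
  rewrite /= -[in LHS](cats0 s); elim: (s) => //= x t ->//.
have sP : is_intpart d (rcons s a.+1) && (size (rcons s a.+1) <= n)%N.
  rewrite /is_intpart size_rcons sn mem_rcons inE negb_or s0 sumn_rcons da.
  rewrite !andbT.
  move: s2; case: (s) s1 => //= x t; rewrite rcons_path => -> /= /(_ isT).
  exact: ltnW.
exists (IntPart sP), k; split; last by rewrite /=; elim: (s) => //= x t ->.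
rewrite /addable /= !nth_rcons ltnn eqxx; case: (posnP (size s)) => //= h.
by rewrite prednK // leqnn nth_last; exact: s2.
Qed.

(** Boxes are added one by one to the empty partition. The multiplicity built here counts the ways
    to reach [l], that is, the standard tableaux of shape [l]. *)
Lemma exp_sum_mul_alternant (K : fieldType) (d n : nat) :
  exists2 m : intpart d n -> nat, (forall l, (0 < m l)%N) &
    (\sum_(i < n) 'X_i) ^+ d * alternant K n [::] =
    \sum_(l : intpart d n) alternant K n l *+ m l.
Proof.
elim: d => [|d [m m_gt0 mE]].
  have nilP : is_intpart 0 [::] && (size (Nil nat) <= n)%N by [].
  exists (fun=> 1%N) => //; rewrite expr0 mul1r (bigD1 (IntPart nilP)) //=.
  rewrite mulr1n big1 ?addr0 // => l /eqP; case; apply/val_inj => /=.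
  have /andP[/and3P[_]] := valP l; rewrite /=.
  by case: (parts l) => // -[|a] s; rewrite ?inE //= addSn.
pose m' (mu : intpart d.+1 n) := (\sum_(l : intpart d n) \sum_(k < n |
  addable l k && (incr_nth (parts l) k == parts mu)) m l)%N.
exists m' => [mu|].
  have [l [k [lk lE]]] := intpart_decr mu.
  rewrite /m' (bigD1 l) //= (bigD1 k) /= ?lk ?lE ?eqxx //.
  by rewrite -addnA addn_gt0 m_gt0.
rewrite exprS -mulrA mE mulr_sumr.
under [RHS]eq_bigr do rewrite -mulr_natr natr_sum mulr_sumr.
rewrite [RHS]exchange_big; apply: eq_bigr => l _ /=.
have /andP[/and3P[sl _ _] _] := valP l.
rewrite mulrnAr sum_mul_alternant // -mulr_natr mulr_suml.
under [RHS]eq_bigr do rewrite natr_sum mulr_sumr big_mkcondr /=.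
rewrite [RHS]exchange_big; apply: eq_bigr => k lk /=.
rewrite (bigD1 (IntPart (intpart_incr lk))) //= eqxx big1 ?addr0 // => mu.
by rewrite eq_sym -val_eqE /= => /negbTE ->.
Qed.

Lemma exp_sum_schur (K : fieldType) (d n : nat) :
  exists2 m : intpart d n -> nat, (forall l, (0 < m l)%N) &
    (\sum_(i < n) 'X_i) ^+ d = \sum_(l : intpart d n) schur K n l *+ m l.
Proof.
have [m m_gt0 mE] := exp_sum_mul_alternant K d n; exists m => //.
apply: (mulIf (alternant0_neq0 K n)); rewrite mE mulr_suml.
by apply: eq_bigr => l _; rewrite mulrnAl schurE.
Qed.

(** * Integration of bounded continuous functions against Haar measure *)

Section HaarIntegral.
Local Open Scope classical_set_scope.
Variables (R : realType) (n : nat).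
Local Notation C := R[i].
Local Notation U := (unitaryG R n).

Lemma normc_Re_le (z : C) : (`|complex.Re z|)%:C%C <= `|z|.
Proof.
case: z => a b; rewrite normc_def lecR /= -sqrtr_sqr.
by rewrite ler_sqrt ?addr_ge0 ?sqr_ge0 // lerDl sqr_ge0.
Qed.

Lemma normc_Im_le (z : C) : (`|complex.Im z|)%:C%C <= `|z|.
Proof.
case: z => a b; rewrite normc_def lecR /= -sqrtr_sqr.
by rewrite ler_sqrt ?addr_ge0 ?sqr_ge0 // lerDr sqr_ge0.
Qed.

Lemma Re_continuous : continuous (@complex.Re R).
Proof.
move=> z A /nbhs_ballP[e /= e0 eA].
apply/nbhs_ballP; exists (e%:C)%C; rewrite /= ?ltcR // => w zw; apply: eA.
rewrite /ball /= -raddfB -ltcR.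
by apply: le_lt_trans (normc_Re_le _) _.
Qed.

Lemma Im_continuous : continuous (@complex.Im R).
Proof.
move=> z A /nbhs_ballP[e /= e0 eA].
apply/nbhs_ballP; exists (e%:C)%C; rewrite /= ?ltcR // => w zw; apply: eA.
rewrite /ball /= -raddfB -ltcR.
by apply: le_lt_trans (normc_Im_le _) _.
Qed.

Lemma umx_entry_continuous k i j :
  continuous (fun x : unitaryG R k => umx x i j).
Proof.
move=> x; apply: (@continuous_comp _ _ _ (@umx R k) (fun M : 'M[C]_k => M i j)).
  exact: initial_continuous.
exact: coord_continuous.
Qed.

Lemma mulg_entry_continuous (g : U) i j :
  continuous (fun x : U => umx (g * x)%g i j).
Proof.
have -> : (fun x : U => umx (g * x)%g i j) =
    (fun x => \sum_k umx g i k * umx x k j).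
  by apply/funext => x; rewrite mxE.
move=> x; have FF : Filter (nbhs x) := nbhs_filter x.
apply: cvg_big => [|k _]; first exact: add_continuous.
apply: cvgMl_tmp; exact: umx_entry_continuous.
Qed.

(** The topology is initial for [umx], so continuity is checked on the finitely many entries of
    [g * x], which are linear in those of [x]. *)
Lemma mulg_continuous (g : U) : continuous (fun x : U => (g * x)%g).
Proof.
apply: continuous_comp_initial => x A [P xP PA].
have h : \forall y \near x, forall ij : 'I_n * 'I_n,
    P ij.1 ij.2 (umx (g * y)%g ij.1 ij.2).
  refine (@filter_forall U ('I_n * 'I_n)%type
    (fun ij y => P ij.1 ij.2 (umx (g * y)%g ij.1 ij.2)) (nbhs x) _ _).
  by move=> -[i j]; exact: (mulg_entry_continuous (xP i j)).
by apply: filterS h => y Py; apply: PA => i j; exact: (Py (i, j)).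
Qed.

(** A class that contains the real and imaginary parts of matrix entries, is closed under sums and
    products, and is integrable for every probability measure. *)
Definition bcont (f : U -> R) : Prop :=
  continuous f /\ exists M, forall x, `|f x| <= M.

Lemma bcontD f g : bcont f -> bcont g ->
  bcont (fun x => f x + g x).
Proof.
move=> [cf [M fM]] [cg [N gN]]; split.
  by move=> x; exact: (cvgD (cf x) (cg x)).
by exists (M + N) => x; apply: le_trans (ler_normD _ _) _; exact: lerD.
Qed.

Lemma bcontM f g : bcont f -> bcont g ->
  bcont (fun x => f x * g x).
Proof.
move=> [cf [M fM]] [cg [N gN]]; split.
  by move=> x; exact: (cvgM (cf x) (cg x)).
by exists (M * N) => x; rewrite normrM ler_pM.
Qed.

Lemma bcont_cst c : bcont (fun=> c).
Proof. by split; [exact: cst_continuous|exists `|c|]. Qed.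

Lemma bcontN f : bcont f ->
  bcont (fun x => - f x).
Proof.
move=> [cf [M fM]]; split; first by move=> x; exact: (cvgN (cf x)).
by exists M => x; rewrite normrN.
Qed.

Definition bcontC (f : U -> C) : Prop :=
  bcont (fun x => complex.Re (f x)) /\
  bcont (fun x => complex.Im (f x)).

Lemma bcontCM f g : bcontC f -> bcontC g -> bcontC (fun x => f x * g x).
Proof.
move=> [f1 f2] [g1 g2]; split.
  have -> : (fun x => complex.Re (f x * g x)) =
      (fun x => complex.Re (f x) * complex.Re (g x) +
                - (complex.Im (f x) * complex.Im (g x))).
    by apply/funext => x; case: (f x) (g x) => [a b] [a' b'].
  apply: bcontD; last apply: bcontN;
  exact: bcontM.
have -> : (fun x => complex.Im (f x * g x)) =
    (fun x => complex.Re (f x) * complex.Im (g x) +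
              complex.Im (f x) * complex.Re (g x)).
  by apply/funext => x; case: (f x) (g x) => [a b] [a' b'].
by apply: bcontD; exact: bcontM.
Qed.

Lemma bcontCD f g : bcontC f -> bcontC g -> bcontC (fun x => f x + g x).
Proof.
move=> [f1 f2] [g1 g2]; split; under eq_fun do rewrite raddfD;
exact: bcontD.
Qed.

Lemma bcontC_cst c : bcontC (fun=> c).
Proof. by split; exact: bcont_cst. Qed.

Lemma bcontC_conj f : bcontC f -> bcontC (fun x => (f x)^*).
Proof.
move=> [f1 f2]; split.
  by have -> : (fun x => complex.Re (f x)^* ) = (fun x => complex.Re (f x));
    [apply/funext => x; case: (f x)|].
have -> : (fun x => complex.Im (f x)^* ) = (fun x => - complex.Im (f x)).
  by apply/funext => x; case: (f x).
exact: bcontN.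
Qed.

Lemma bcontC_sum (I : Type) (r : seq I) (P : pred I) (F : I -> U -> C) :
  (forall i, P i -> bcontC (F i)) ->
  bcontC (fun x => \sum_(i <- r | P i) F i x).
Proof.
move=> nF; elim: r => [|i r IH].
  by under eq_fun do rewrite big_nil; exact: bcontC_cst.
under eq_fun do rewrite big_cons.
by case: (boolP (P i)) => [/nF Fi|_] //; exact: bcontCD.
Qed.

(** The rows of a unitary matrix have norm 1, and the squared modulus of an entry is one of the
    non-negative terms of this norm. *)
Lemma unitary_entry_le1 k (A : 'M[C]_k) i j : A \is unitarymx -> `|A i j| <= 1.
Proof.
move=> /unitarymxP /matrixP /(_ i i); rewrite !mxE eqxx => /esym Aii.
rewrite -(@expr_le1 _ 2) // [leRHS](Aii : 1 = _) (bigD1 j) //= !mxE.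
rewrite -normCK lerDl.
by apply: sumr_ge0 => l _; rewrite !mxE mul_conjC_ge0.
Qed.

Lemma bcontC_entry (rho : unitary_rep R n) i j :
  bcontC (fun x => rep_mx rho x i j).
Proof.
have cont x : {for x, continuous (fun x => rep_mx rho x i j)}.
  apply: (@continuous_comp _ _ _ rho (fun y => umx y i j)).
    exact: urep_continuous.
  exact: umx_entry_continuous.
split; split.
- by move=> x; apply: continuous_comp; [exact: cont|exact: Re_continuous].
- exists 1 => x; rewrite -lecR; apply: le_trans (normc_Re_le _) _.
  exact/unitary_entry_le1/umxP.
- by move=> x; apply: continuous_comp; [exact: cont|exact: Im_continuous].
- exists 1 => x; rewrite -lecR; apply: le_trans (normc_Im_le _) _.
  exact/unitary_entry_le1/umxP.
Qed.

Variable mu : probability (borelU R n) R.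

Lemma bcont_measurable f : bcont f ->
  measurable_fun [set: borelU R n] f.
Proof.
move=> [cf _]; apply: (measurability _ (RGenOpens.measurableE R)).
move=> _ [B [a [b ->]] <-]; rewrite setTI; apply: sub_sigma_algebra.
by apply: open_comp => [x _|]; [exact: cf|exact: interval_open].
Qed.

Lemma bcont_integrable f : bcont f ->
  mu.-integrable setT (EFin \o f).
Proof.
move=> bf; apply: measurable_bounded_integrable => //.
- by apply: le_lt_trans (probability_le1 mu _) _; rewrite // ltry.
- exact: bcont_measurable.
- case: bf => _ [M fM]; exists M; split; first exact: num_real.
  by move=> N MN x _; apply: le_trans (fM x) (ltW MN).
Qed.

Lemma CintegralD f g : bcontC f -> bcontC g ->
  Cintegral mu (fun x => f x + g x) = Cintegral mu f + Cintegral mu g.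
Proof.
move=> [f1 f2] [g1 g2]; rewrite /Cintegral.
under eq_Rintegral do rewrite raddfD.
under [X in Complex _ X]eq_Rintegral do rewrite raddfD.
by rewrite !RintegralD //; exact: bcont_integrable.
Qed.

Lemma CintegralZ c f : bcontC f ->
  Cintegral mu (fun x => c * f x) = c * Cintegral mu f.
Proof.
case: c => a b [f1 f2]; rewrite /Cintegral.
have E1 x : complex.Re (Complex a b * f x) =
    a * complex.Re (f x) - b * complex.Im (f x) by case: (f x).
have E2 x : complex.Im (Complex a b * f x) =
    a * complex.Im (f x) + b * complex.Re (f x) by case: (f x).
under eq_Rintegral do rewrite E1.
under [X in Complex _ X]eq_Rintegral do rewrite E2.
have ia g c : bcont g ->
    mu.-integrable setT (EFin \o (fun x => c * g x)).
  move=> bg; apply: bcont_integrable.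
  by apply: bcontM => //; exact: bcont_cst.
rewrite RintegralB ?RintegralD ?RintegralZl //; try exact: ia;
exact: bcont_integrable.
Qed.

Lemma Cintegral_cst c : Cintegral mu (fun=> c) = c.
Proof.
rewrite /Cintegral !Rintegral_cst //.
have -> : fine (mu setT) = 1 by rewrite probability_setT.
by case: c => a b /=; rewrite !mulr1.
Qed.

Lemma Cintegral_sum (I : Type) (r : seq I) (P : pred I) (c : I -> C)
    (F : I -> U -> C) :
  (forall i, P i -> bcontC (F i)) ->
  Cintegral mu (fun x => \sum_(i <- r | P i) c i * F i x) =
  \sum_(i <- r | P i) c i * Cintegral mu (F i).
Proof.
move=> nF; elim: r => [|i r IH].
  rewrite big_nil -[RHS]Cintegral_cst; congr Cintegral.
  by apply/funext => x; rewrite big_nil.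
rewrite big_cons; under [in LHS]eq_fun do rewrite big_cons.
case: (boolP (P i)) => [Pi|_] //.
have nc j : P j -> bcontC (fun x => c j * F j x).
  by move=> Pj; apply: bcontCM; [exact: bcontC_cst|exact: nF].
rewrite CintegralD ?CintegralZ ?IH //; [exact: nF|exact: nc|exact: bcontC_sum].
Qed.

Hypothesis mu_haar : is_haar mu.

Lemma mulg_measurable (g : U) :
  measurable_fun [set: borelU R n]
    (fun x : borelU R n => (g * x)%g : borelU R n).
Proof.
apply: (@measurability _ _ (borelU R n) (borelU R n) _ _ (@open U)) => //.
move=> _ [B oB <-]; rewrite setTI; apply: sub_sigma_algebra.
by apply: open_comp => // x _; exact: mulg_continuous.
Qed.

(** The left side is the integral of [f] against the pushforward of [mu] under translation by [g],
    which is [mu] again. *)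
Lemma Rintegral_mulg (g : U) f : bcont f ->
  Rintegral mu setT (fun x => f (g * x)%g) = Rintegral mu setT f.
Proof.
move=> bf; rewrite /Rintegral; congr fine.
have bfg : bcont (fun x => f (g * x)%g).
  case: bf => cf [M fM]; split; last by exists M.
  by move=> x; apply: continuous_comp; [exact: mulg_continuous|exact: cf].
have := @integral_pushforward _ _ _ _ R _ (mulg_measurable g) mu setT
  (EFin \o f).
rewrite preimage_setT => <- //.
- by apply: eq_measure_integral => [|mg A mA _];
    [exact: mulg_measurable|exact: mu_haar].
- by apply/measurable_EFinP; exact: bcont_measurable.
- exact: (bcont_integrable bfg).
Qed.

Lemma Cintegral_mulg (g : U) f : bcontC f ->
  Cintegral mu (fun x => f (g * x)%g) = Cintegral mu f.
Proof.
move=> [f1 f2].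
by rewrite /Cintegral (Rintegral_mulg g f1) (Rintegral_mulg g f2).
Qed.

End HaarIntegral.

(** * Schur's lemma *)

(** The kernel of [B] is stable under [sigma] and its image under [rho]; irreducibility leaves only
    [B = 0] or [B] bijective. *)
Lemma schur_lemma (K : fieldType) (G : Type) (k l : nat)
    (rho : G -> 'M[K]_k) (sigma : G -> 'M[K]_l) (B : 'M[K]_(k, l)) :
  irreducible_rep rho -> irreducible_rep sigma ->
  (forall g, rho g *m B = B *m sigma g) ->
  B = 0 \/ exists B', B *m B' = 1%:M /\ B' *m B = 1%:M.
Proof.
move=> [_ irho] [_ isig] rB.
pose f : 'Hom('cV[K]_l, 'cV[K]_k) := linfun (mulmx B).
have fE v : f v = B *m v by rewrite lfunE.
have B0 : (forall v, f v = 0) -> B = 0.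
  move=> f0; apply/matrixP => i j; rewrite mxE.
  by have := congr1 (fun w : 'cV[K]_k => w i 0) (f0 (delta_mx j 0));
    rewrite fE -colE !mxE.
have [|ker0|kerT] := isig (lker f).
- move=> g v; rewrite !memv_ker !fE mulmxA -rB -mulmxA => /eqP ->.
  by rewrite mulmx0.
- have [|img0|imgT] := irho (limg f).
  + move=> g _ /memv_imgP[v _ ->]; rewrite fE mulmxA rB -mulmxA -fE.
    by rewrite memv_img ?memvf.
  + left; apply: B0 => v; apply/eqP; rewrite -memv0 -img0.
    by rewrite memv_img ?memvf.
  + right.
    (* Preimages of the standard basis vectors are the columns of a right inverse. *)
    have [w wE] : exists w : 'I_k -> 'cV[K]_l,
        forall i, B *m w i = delta_mx i 0.
      suff h i : exists w : 'cV[K]_l, B *m w = delta_mx i 0.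
        by have [w wE] := boolp.choice h; exists w.
      have /memv_imgP[w _ wE] : delta_mx i 0 \in limg f by rewrite imgT memvf.
      by exists w; rewrite wE fE.
    pose B' := \matrix_(a, i) w i a 0.
    have BB' : B *m B' = 1%:M.
      apply/matrixP => a i; have := congr1 (fun u : 'cV[K]_k => u a 0) (wE i).
      rewrite !mxE eqxx andbT => <-.
      by apply: eq_bigr => b _; rewrite mxE.
    (* It is also a left inverse: [B] kills every column of [B' *m B - 1%:M] and has trivial
       kernel. *)
    exists B'; split => //; apply/subr0_eq/matrixP => a j; rewrite [RHS]mxE.
    have : col j (B' *m B - 1%:M) \in lker f.
      rewrite memv_ker fE colE mulmxA mulmxBr mulmxA BB' mul1mx mulmx1.
      by rewrite subrr mul0mx.
    rewrite ker0 memv0 => /eqP/colP/(_ a); rewrite !mxE; exact.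
- left; apply: B0 => v; apply/eqP; rewrite -memv_ker kerT; exact: memvf.
Qed.

(** For an eigenvalue [a] of [B], which exists because [k] is positive, [B - a%:M] still commutes
    with [rho] but is not invertible, so it vanishes. *)
Lemma schur_scalar (C : closedFieldType) (G : Type) (k : nat)
    (rho : G -> 'M[C]_k) (B : 'M[C]_k) :
  irreducible_rep rho -> (forall g, rho g *m B = B *m rho g) ->
  exists a, B = a%:M.
Proof.
move=> irho rB; have k_gt0 := irho.1.
have /closed_rootP[a] : size (char_poly B) != 1%N.
  by rewrite size_char_poly; case: (k) k_gt0.
rewrite -eigenvalue_root_char => /eigenvalueP[v vB v0]; exists a.
have [g||[B' [BB' _]]] := schur_lemma (B := B - a%:M) irho irho.
- by rewrite mulmxBr mulmxBl rB scalar_mxC.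
- exact: subr0_eq.
- case/eqP: v0; rewrite -[v]mulmx1 -BB' mulmxA mulmxBr vB mul_mx_scalar.
  by rewrite subrr mul0mx.
Qed.

Lemma sum_tens_index (V : nmodType) (k l : nat) (F : 'I_(k * l) -> V) :
  \sum_p F p = \sum_i \sum_j F (mxtens_index (i, j)).
Proof.
rewrite pair_big (reindex (@mxtens_index k l)) /=.
  by apply: eq_bigr => -[i j].
by exists (@mxtens_unindex k l) => p _; rewrite ?mxtens_indexK ?mxtens_unindexK.
Qed.

(** * Schur's orthogonality relations *)

Section SchurOrthogonality.
Variables (R : realType) (n : nat).
Local Notation C := R[i].
Local Notation U := (unitaryG R n).
Local Open Scope sesquilinear_scope.

Lemma rep_mxM (rho : unitary_rep R n) (g h : U) :
  rep_mx rho (g * h)%g = rep_mx rho g *m rep_mx rho h.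
Proof. by rewrite /rep_mx urep_morph. Qed.

Lemma rep_mx_unitary (rho : unitary_rep R n) (g : U) :
  rep_mx rho g *m (rep_mx rho g)^t* = 1%:M.
Proof. exact/unitarymxP/umxP. Qed.

Lemma rep_mx_unitaryV (rho : unitary_rep R n) (g : U) :
  (rep_mx rho g)^t* *m rep_mx rho g = 1%:M.
Proof. exact/mulmx1C/rep_mx_unitary. Qed.

Lemma rep_mx1 (rho : unitary_rep R n) : rep_mx rho 1%g = 1%:M.
Proof.
by rewrite -[LHS]mulmx1 -(rep_mx_unitary rho 1%g) mulmxA -rep_mxM mul1g.
Qed.

Lemma rep_mxV (rho : unitary_rep R n) (g : U) :
  rep_mx rho g^-1%g = (rep_mx rho g)^t*.
Proof.
rewrite -[LHS]mulmx1 -(rep_mx_unitary rho g) mulmxA -rep_mxM mulVg.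
by rewrite rep_mx1 mul1mx.
Qed.

Variable mu : probability (borelU R n) R.
Hypothesis mu_haar : is_haar mu.

(** For fixed [a] and [b] this is the entry [(i, j)] of the average of [rho(x) E_ab sigma(x)^*],
    where [E_ab] is a matrix unit. *)
Definition coef_dot (rho sigma : unitary_rep R n) i a j b : C :=
  Cintegral mu (fun x => rep_mx rho x i a * (rep_mx sigma x j b)^*).

Arguments coef_dot : clear implicits.

(** Replacing [x] by [g * x] under the integral shows that the averaged matrix [B] satisfies
    [rho(g) B sigma(g)^* = B]; unitarity of [sigma(g)] moves the last factor across. *)
Lemma coef_dot_intertwines (rho sigma : unitary_rep R n) a b (g : U) :
  rep_mx rho g *m (\matrix_(i, j) coef_dot rho sigma i a j b) =
  (\matrix_(i, j) coef_dot rho sigma i a j b) *m rep_mx sigma g.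
Proof.
set B := \matrix_(i, j) _.
suff BE : rep_mx rho g *m B *m (rep_mx sigma g)^t* = B.
  by rewrite -[in RHS]BE -mulmxA rep_mx_unitaryV mulmx1.
apply/matrixP => i j; rewrite [RHS]mxE /coef_dot.
rewrite -(Cintegral_mulg mu_haar g); last first.
  by apply: bcontCM; [|apply: bcontC_conj]; exact: bcontC_entry.
rewrite mxE.
under eq_bigr do rewrite mxE mulr_suml.
rewrite pair_big /=.
have nF (p : 'I_(udim sigma) * 'I_(udim rho)) :
    bcontC (fun x => rep_mx rho x p.2 a * (rep_mx sigma x p.1 b)^*).
  by apply: bcontCM; [|apply: bcontC_conj]; exact: bcontC_entry.
transitivity (\sum_p (rep_mx rho g i p.2 * (rep_mx sigma g j p.1)^*) *
    Cintegral mu (fun x => rep_mx rho x p.2 a * (rep_mx sigma x p.1 b)^*)).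
  by apply: eq_bigr => p _; rewrite !mxE /coef_dot; ring.
rewrite -(@Cintegral_sum _ _ mu _ _ xpredT _ (fun p x => _) (fun p _ => nF p)).
congr Cintegral; apply/funext => x; rewrite !rep_mxM !mxE.
rewrite rmorph_sum [RHS]mulr_suml.
under [RHS]eq_bigr do rewrite mulr_sumr.
rewrite [RHS]exchange_big pair_big /=; apply: eq_bigr => p _.
by rewrite rmorphM /=; ring.
Qed.

Lemma coef_dot_inequiv (rho sigma : unitary_rep R n) i a j b :
  irreducible_rep (rep_mx rho) -> irreducible_rep (rep_mx sigma) ->
  ~ equiv_rep (rep_mx rho) (rep_mx sigma) -> coef_dot rho sigma i a j b = 0.
Proof.
move=> irho isig neq.
have rB := @coef_dot_intertwines rho sigma a b.
have [/matrixP/(_ i j)|[B' [BB' B'B]]] := schur_lemma irho isig rB.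
  by rewrite !mxE.
case: neq; exists (\matrix_(i, j) coef_dot rho sigma i a j b), B'.
by split.
Qed.

(** The averaged matrix is a scalar [c%:M]. Its trace gives [c]: the columns of [rho(x)] are
    orthonormal, so the integrand of the trace is constantly 1 or 0. *)
Lemma coef_dot_irr (rho : unitary_rep R n) i a j b :
  irreducible_rep (rep_mx rho) ->
  coef_dot rho rho i a j b = ((i == j) && (a == b))%:R / (udim rho)%:R.
Proof.
move=> irho; have k_gt0 := irho.1.
have rB := @coef_dot_intertwines rho rho a b.
have [c cE] := schur_scalar irho rB.
have kc : (udim rho)%:R * c = (a == b)%:R.
  rewrite mulr_natl -mxtrace_scalar -cE /mxtrace.
  transitivity (Cintegral mu (fun x => \sum_i 1 *
      (rep_mx rho x i a * (rep_mx rho x i b)^*))).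
    rewrite (@Cintegral_sum _ _ mu _ _ xpredT (fun=> 1)) => [|l _].
      by apply: eq_bigr => l _; rewrite mxE mul1r.
    by apply: bcontCM; [|apply: bcontC_conj]; exact: bcontC_entry.
  rewrite -[RHS](Cintegral_cst mu); congr Cintegral; apply/funext => x.
  have := congr1 (fun A : 'M[C]_(udim rho) => A b a) (rep_mx_unitaryV rho x).
  rewrite !mxE eq_sym => <-.
  by apply: eq_bigr => l _; rewrite !mxE mul1r mulrC.
have := congr1 (fun A : 'M[C]_(udim rho) => A i j) cE; rewrite !mxE => ->.
have k0 : (udim rho)%:R != 0 :> C by rewrite pnatr_eq0 -lt0n.
have -> : c = (a == b)%:R / (udim rho)%:R by rewrite -kc mulrAC divff ?mul1r.
by case: (i == j); rewrite ?mulr1n //= mulr0n mul0r.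
Qed.

(* The general coefficient of the contragredient, whose matrix is the entrywise
   conjugate of that of [rho]. *)
Definition rep_coef (rho : unitary_rep R n)
    (v : 'cV[C]_(udim rho * udim rho)) (x : U) : C :=
  \sum_i \sum_a v (mxtens_index (i, a)) 0 * rep_mx rho x i a.

Lemma rep_coef_linear rho : linear (@rep_coef rho).
Proof.
move=> c v w; apply/funext => x; rewrite /rep_coef !fctE.
rewrite scaler_sumr -big_split; apply: eq_bigr => i _ /=.
rewrite scaler_sumr -big_split; apply: eq_bigr => a _ /=.
by rewrite !mxE mulrDl scalerAl.
Qed.

HB.instance Definition _ rho := GRing.isLinear.Build C
  'cV[C]_(udim rho * udim rho) (U -> C) _ (@rep_coef rho)
  (@rep_coef_linear rho).

Lemma L2dot_rep_coef rho sigma v w :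
  L2dot mu (@rep_coef rho v) (@rep_coef sigma w) =
  \sum_i \sum_a \sum_j \sum_b v (mxtens_index (i, a)) 0 *
    (w (mxtens_index (j, b)) 0)^* * coef_dot rho sigma i a j b.
Proof.
rewrite pair_big /=.
under [RHS]eq_bigr do rewrite pair_big.
rewrite pair_big /= /coef_dot.
rewrite -(@Cintegral_sum _ _ mu _ _ xpredT (fun p => _) (fun p x => _));
  last first => [p _|].
  by apply: bcontCM; [|apply: bcontC_conj]; exact: bcontC_entry.
congr Cintegral; apply/funext => x; rewrite /rep_coef !pair_big /=.
rewrite [X in _ * X]rmorph_sum [LHS]mulr_suml.
under [LHS]eq_bigr do rewrite mulr_sumr.
rewrite pair_big /=; apply: eq_bigr => p _; rewrite rmorphM /=; ring.
Qed.

Lemma L2dot_rep_coef_irr rho v : irreducible_rep (rep_mx rho) ->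
  L2dot mu (@rep_coef rho v) (@rep_coef rho v) =
  (udim rho)%:R^-1 * \sum_p `|v p 0| ^+ 2.
Proof.
move=> irho; rewrite L2dot_rep_coef.
under eq_bigr do under eq_bigr do
  (under eq_bigr do (under eq_bigr do rewrite coef_dot_irr //)).
rewrite sum_tens_index mulr_sumr; apply: eq_bigr => i _.
rewrite mulr_sumr; apply: eq_bigr => a _.
rewrite (bigD1 i) //= (bigD1 a) //= !eqxx big1 => [|b ba]; last first.
  by rewrite eq_sym (negbTE ba) andbF mul0r mulr0.
rewrite big1 => [|j ji]; last first.
  by rewrite big1 // => b _; rewrite eq_sym (negbTE ji) mul0r mulr0.
by rewrite !addr0 mul1r mulrC normCK.
Qed.

Lemma L2dot_rep_coef_eq0 rho v : irreducible_rep (rep_mx rho) ->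
  L2dot mu (@rep_coef rho v) (@rep_coef rho v) = 0 -> v = 0.
Proof.
move=> irho /eqP; rewrite L2dot_rep_coef_irr // mulf_eq0 invr_eq0 pnatr_eq0.
rewrite gtn_eqF ?irho.1 //= => /eqP/psumr_eq0P h.
apply/colP => p; rewrite mxE; apply/eqP.
by rewrite -normr_eq0 -sqrf_eq0; apply/eqP/h => // q _; exact: exprn_ge0.
Qed.

(** This is linear independence of the entries of an irreducible [rho]: the squared L2 norm of a
    combination is a positive multiple of the squared norm of its coefficients. *)
Lemma rep_coef_inj rho :
  irreducible_rep (rep_mx rho) -> injective (@rep_coef rho).
Proof.
move=> irho; apply: raddf_inj => v v0; apply: (L2dot_rep_coef_eq0 irho).
rewrite v0 /L2dot -[RHS](Cintegral_cst mu).
by congr Cintegral; apply/funext => x; rewrite mul0r.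
Qed.

End SchurOrthogonality.

(** * Polynomials vanishing on the torus *)

Lemma meval_muni (K : comNzRingType) (n : nat) (p : {mpoly K[n.+1]})
    (v : 'I_n.+1 -> K) :
  p.@[v] =
  (map_poly (meval (fun i => v (widen_ord (leqnSn n) i))) (muni p)).[v ord_max].
Proof.
rewrite mevalE muniE !rmorph_sum horner_sum; apply: eq_bigr => m _ /=.
rewrite big_ord_recr /= -mul_polyC rmorphM /= map_polyC map_polyXn /=.
rewrite hornerCM hornerXn mevalZ mevalX mulrA; congr (_ * _ * _).
by apply: eq_bigr => i _; rewrite mnmE.
Qed.

(** A coefficient of [p] is recovered from [muni p] by reading off first the exponent of the last
    variable, then the remaining ones. *)
Lemma muni_eq0 (K : comNzRingType) (n : nat) (p : {mpoly K[n.+1]}) :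
  muni p = 0 -> p = 0.
Proof.
move=> p0; apply/mpolyP => m; rewrite mcoeff0.
have := congr1 (fun q : {poly {mpoly K[n]}} =>
  q`_(m ord_max)@_[multinom m (widen_ord (leqnSn n) i) | i < n]) p0.
rewrite coef0 mcoeff0 muniE coef_sum raddf_sum /= => h.
rewrite [p in LHS]mpolyE raddf_sum /= -[RHS]h.
apply: eq_bigr => m' _; rewrite mcoeffZ mcoeffX coefZ coefXn.
have -> : (m' == m) = ([multinom m' (widen_ord (leqnSn n) i) | i < n] ==
    [multinom m (widen_ord (leqnSn n) i) | i < n]) && (m ord_max == m' ord_max).
  apply/eqP/andP => [-> //|[/eqP/mnmP E /eqP E']]; apply/mnmP => i.
  have [j ->|->] := unliftP ord_max i; last by rewrite E'.
  have := E j; rewrite !mnmE.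
  by have -> : widen_ord (leqnSn n) j = lift ord_max j
    by apply/val_inj; rewrite /= /bump leqNgt ltn_ord.
case: (m ord_max == _); rewrite ?mulr1 ?mulr0 ?mcoeff0 ?andbF ?mulr0 // andbT.
by rewrite mcoeffZ mcoeffX.
Qed.

(** Induction on the number of variables. With all but the last variable fixed in [S], a polynomial
    in the last one has too many roots and vanishes; hence its coefficients vanish at all points
    over [S], and the induction hypothesis applies to them. *)
Lemma mpoly_eq0_infinite (K : idomainType) (S : K -> Prop) :
  (forall N, exists s : seq K,
     [/\ uniq s, size s = N & forall x, x \in s -> S x]) ->
  forall (n : nat) (p : {mpoly K[n]}),
  (forall v, (forall i, S (v i)) -> p.@[v] = 0) -> p = 0.
Proof.
move=> infS; elim=> [|n IH] p p0.
  have := p0 (fun i : 'I_0 => 0) (fun i => match notF (valP i) with end).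
  have -> : p = (p@_0%MM)%:MP.
    apply/mpolyP => m; rewrite mcoeffC.
    have -> : m = 0%MM by apply/mnmP => -[].
    by rewrite eqxx mulr1.
  by rewrite mevalC => ->; rewrite mpolyC0.
apply: muni_eq0; apply/polyP => k; rewrite coef0; apply: IH => v Sv.
pose q := map_poly (meval v) (muni p).
suff q0 : q = 0 by have := coef_map (meval v) (muni p) k; rewrite -/q q0 coef0.
apply/eqP; apply: contraT => q0.
(* A non-zero [q] has fewer than [size q] roots. *)
have [s [us ss sS]] := infS (size q).
have /(max_poly_roots q0)/(_ us) : all (root q) s; last by rewrite ss ltnn.
apply/allP => x /sS Sx; apply/rootP.
pose v' (i : 'I_n.+1) := if unlift ord_max i is Some j then v j else x.
have := p0 v'; rewrite meval_muni /v' unlift_none.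
have -> : map_poly (meval (fun i => if unlift ord_max (widen_ord (leqnSn n) i)
    is Some j then v j else x)) (muni p) = q.
  apply/polyP => j; rewrite !coef_map /=; apply: meval_eq => i.
  have -> : widen_ord (leqnSn n) i = lift ord_max i
    by apply/val_inj; rewrite /= /bump leqNgt ltn_ord.
  by rewrite liftK.
by apply => i; case: unliftP => [j|].
Qed.

(** The points are [(k + i) / (k - i)] for natural [k]. Equality for [k] and [l] gives
    [2 i (k - l) = 0] after cross-multiplication. *)
Lemma unit_circle_infinite (C : numClosedFieldType) (N : nat) :
  exists s : seq C, [/\ uniq s, size s = N & forall x, x \in s -> `|x| = 1].
Proof.
pose w (k : nat) : C := k%:R + 'i.
have wc k : (w k)^* = k%:R - 'i by rewrite rmorphD /= rmorph_nat conjCi.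
have w0 k : w k != 0.
  apply/eqP => wk; have := congr1 (fun z => 'Im z) wk.
  rewrite raddfD /= Im_i raddf0 /= (Creal_ImP _ _) ?realn // add0r.
  by move/eqP; rewrite oner_eq0.
exists [seq w k / (w k)^* | k <- iota 0 N]; split.
- rewrite map_inj_uniq ?iota_uniq // => k l /eqP.
  rewrite eqr_div ?conjC_eq0 // !wc /w => /eqP h.
  have /eqP : ('i *+ 2) * (k%:R - l%:R : C) = 0.
    transitivity ((l%:R + 'i) * (k%:R - 'i) - (k%:R + 'i) * (l%:R - 'i) : C).
      by ring.
    by rewrite h subrr.
  rewrite mulf_eq0 mulrn_eq0 /= (negbTE (neq0Ci _)) /= subr_eq0 eqr_nat.
  by move/eqP.
- by rewrite size_map size_iota.
- by move=> _ /mapP[k _ ->]; rewrite normf_div norm_conjC divff // normr_eq0.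
Qed.

(** * Alternants and characters determine the partition *)

Definition shifted_exp (n : nat) (l : seq nat) (i : 'I_n) : nat :=
  nth 0 l i + (n - i.+1).

Lemma shifted_exp_decr (n : nat) (l : seq nat) (i j : 'I_n) : sorted geq l ->
  (i < j)%N -> (shifted_exp l j < shifted_exp l i)%N.
Proof.
move=> sl ij; rewrite /shifted_exp.
have lij : (nth 0 l j <= nth 0 l i)%N.
  have [jl|jl] := ltnP j (size l); last by rewrite (nth_default _ jl).
  have geq_trans : transitive geq by move=> a b c ba ac; exact: leq_trans ac ba.
  apply: (sorted_leq_nth geq_trans (fun a => leqnn a) 0%N sl) (ltnW ij) => //.
  by rewrite inE (ltn_trans ij).
apply: (@leq_ltn_trans (nth 0 l i + (n - j.+1))%N); first by rewrite leq_add2r.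
by rewrite ltn_add2l ltn_sub2lE.
Qed.

Lemma shifted_exp_inj (n : nat) (l : seq nat) : sorted geq l ->
  injective (@shifted_exp n l).
Proof.
move=> sl i j eij; case: (ltngtP i j) => [ij|ji|/ord_inj //].
  by have := shifted_exp_decr sl ij; rewrite eij ltnn.
by have := shifted_exp_decr sl ji; rewrite eij ltnn.
Qed.

Lemma alternantE (K : fieldType) (n : nat) (l : seq nat) :
  alternant K n l = \sum_(s : 'S_n)
    (-1) ^+ s *: 'X_[[multinom shifted_exp l (s i) | i < n]].
Proof.
apply: eq_bigr => s _; rewrite mpolyXE_id -mul_mpolyC rmorph_sign.
by congr (_ * _); apply: eq_bigr => i _; rewrite mxE mnmE.
Qed.

(** The shifted exponents of [l] are distinct, so their monomial has coefficient 1 in the alternant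
    of [l]. It then occurs in that of [m], so both exponent sequences have the same members; being
    strictly decreasing, they agree. *)
Lemma alternant_inj (K : fieldType) (d n : nat) (l m : intpart d n) :
  alternant K n l = alternant K n m -> l = m.
Proof.
have /andP[/and3P[sl l0 _] nl] := valP l.
have /andP[/and3P[sm m0 _] nm] := valP m.
rewrite /= in sl l0 nl sm m0 nm.
move=> /(congr1 (mcoeff [multinom shifted_exp l i | i < n])).
rewrite !alternantE !raddf_sum (bigD1 (1%g : 'S_n)) //= odd_perm1 expr0 scale1r.
rewrite mcoeffX big1 => [|s s1]; last first.
  rewrite mcoeffZ mcoeffX; case: eqP => [/mnmP sE|]; last by rewrite mulr0.
  case/eqP: s1; apply/permP => i; have := sE i; rewrite !mnmE perm1.
  exact: shifted_exp_inj.
have -> : [multinom shifted_exp l ((1%g : 'S_n) i) | i < n] =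
    [multinom shifted_exp l i | i < n].
  by apply/mnmP => i; rewrite !mnmE perm1.
rewrite eqxx addr0 => h.
(* Were no permutation to match, every term on the right would contribute 0 to a coefficient equal
   to 1. *)
have [s sE] : exists s : 'S_n, forall i, shifted_exp m (s i) = shifted_exp l i.
  apply: contrapT => /forallNP ns; have /eqP := h.
  rewrite big1 ?oner_eq0 // => s _.
  rewrite mcoeffZ mcoeffX; case: eqP => [/mnmP sE|]; last by rewrite mulr0.
  by case: (ns s) => i; have := sE i; rewrite !mnmE.
have decr k : sorted geq k -> sorted gtn (map (@shifted_exp n k) (enum 'I_n)).
  move=> sk.
  apply: (homo_sorted (e := fun i j : 'I_n => (i < j)%N)) => [i j|].
    exact: shifted_exp_decr.
  rewrite -[sorted _ _](@sorted_map _ _ (@nat_of_ord n) ltn) val_enum_ord.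
  exact: iota_ltn_sorted.
have eqlm : map (@shifted_exp n l) (enum 'I_n) =
    map (@shifted_exp n m) (enum 'I_n).
  have gtn_trans : transitive gtn by move=> a b c ba ac; exact: ltn_trans ac ba.
  apply: (irr_sorted_eq gtn_trans) (decr _ sl) (decr _ sm) _ => [a|a].
    exact: ltnn.
  apply/mapP/mapP => -[i _ ->]; first by exists (s i); rewrite ?mem_enum.
  by exists (s^-1 i)%g; rewrite ?mem_enum // -sE permKV.
have nthE i : (i < n)%N -> nth 0%N l i = nth 0%N m i.
  move=> i_n; have /eq_in_map/(_ (Ordinal i_n)) := eqlm.
  by rewrite mem_enum => /(_ isT)/eqP; rewrite eqn_add2r => /eqP.
(* Agreement of [nth] does not see trailing zeros; the lengths agree because all parts are
   non-zero. *)
have szP (a b : intpart d n) :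
    (forall i, (i < n)%N -> nth 0%N a i = nth 0%N b i) ->
    (size a <= size b)%N.
  move=> ab; rewrite leqNgt; apply/negP => ba.
  have /andP[/and3P[_ a0 _] na] := valP a.
  have := ab _ (leq_trans ba na); rewrite [RHS]nth_default // => az.
  by case/negP: a0; rewrite /= -az mem_nth.
apply: val_inj; apply: (@eq_from_nth _ 0%N) => /= [|i il].
  apply/eqP; rewrite eqn_leq !szP // => i i_n; exact/esym/nthE.
by apply: nthE; exact: leq_trans il nl.
Qed.

Lemma equiv_rep_trace (K : fieldType) (G : Type) (k l : nat)
    (rho : G -> 'M[K]_k) (sigma : G -> 'M[K]_l) :
  equiv_rep rho sigma -> forall g, \tr (rho g) = \tr (sigma g).
Proof.
move=> [A [B [AB BA rA]]] g.
by rewrite -[rho g]mulmx1 -AB mulmxA rA -mulmxA mxtrace_mulC -mulmxA BA mulmx1.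
Qed.

Lemma is_eigs_exists (R : realType) (n : nat) (A : 'M[R[i]]_n) :
  exists x, is_eigs A x.
Proof.
have [r] := closed_field_poly_normal (char_poly A).
rewrite (monicP (char_poly_monic A)) scale1r => rE.
have rn : size r = n.
  by have := size_char_poly A; rewrite rE size_prod_XsubC => -[].
exists (fun i => r`_i); rewrite /is_eigs rE (big_nth 0) rn big_mkord.
by [].
Qed.

(** Both sides are, up to sign, the subleading coefficient of the characteristic polynomial. This
    coefficient exists only for positive [n], hence the separate case. *)
Lemma is_eigs_trace (R : realType) (n : nat) (A : 'M[R[i]]_n) x :
  is_eigs A x -> \tr A = \sum_i x i.
Proof.
case: n A x => [|n] A x Ax.
  by rewrite /mxtrace !big_ord0.
apply: oppr_inj; rewrite -(char_poly_trace A) // Ax.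
have sz : size [seq x i | i <- enum 'I_n.+1] = n.+1.
  by rewrite size_map size_enum_ord.
have := @coefPn_prod_XsubC _ [seq x i | i <- enum 'I_n.+1].
by rewrite sz !big_map [index_enum _]unlock => ->.
Qed.

Lemma meval_torus_inj (C : numClosedFieldType) (n : nat) (p q : {mpoly C[n]}) :
  (forall t : 'I_n -> C, (forall i, `|t i| = 1) -> p.@[t] = q.@[t]) -> p = q.
Proof.
move=> pq; apply/subr0_eq.
apply: (mpoly_eq0_infinite (@unit_circle_infinite C)) => t /pq pqt.
by rewrite mevalB pqt subrr.
Qed.

Lemma schur_torus_inj (C : numClosedFieldType) (d n : nat)
    (l m : intpart d n) :
  (forall t : 'I_n -> C, (forall i, `|t i| = 1) ->
     (schur C n l).@[t] = (schur C n m).@[t]) ->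
  l = m.
Proof.
move=> /meval_torus_inj lm; apply: (@alternant_inj C).
by rewrite -schurE lm schurE.
Qed.

(** Every point of the torus is the family of eigenvalues of a unitary diagonal matrix, so equal
    characters give Schur polynomials that agree on the torus. *)
Lemma schur_rep_inj (R : realType) (d n : nat) (l m : intpart d n)
    (rho sigma : unitary_rep R n) :
  is_schur_rep l rho -> is_schur_rep m sigma ->
  (forall g, \tr (rep_mx rho g) = \tr (rep_mx sigma g)) -> l = m.
Proof.
move=> [_ rhoE] [_ sigE] trE; apply: (@schur_torus_inj R[i]) => t t1.
have tU : diag_mx (\row_i t i) \is unitarymx.
  apply/unitarymxP; rewrite tr_diag_mx map_diag_mx mulmx_diag.
  rewrite -[RHS](@diag_const_mx _ n 1); congr diag_mx; apply/rowP => i.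
  by rewrite !mxE -normCK t1 expr1n.
have teig : is_eigs (umx (UnitaryG tU)) t.
  rewrite /is_eigs /= char_poly_trig ?diag_mx_is_trig //.
  by apply: eq_bigr => i _; rewrite !mxE eqxx.
by have := trE (UnitaryG tU); rewrite (rhoE _ _ teig) (sigE _ _ teig).
Qed.

(** * The common kernel of monomials and matrix entries *)

Section Kernel.
Variables (R : realType) (d n : nat) (pi : intpart d n -> unitary_rep R n).
Hypothesis pi_schur : forall l : intpart d n, is_schur_rep (parts l) (pi l).
Local Notation C := R[i].
Local Notation U := (unitaryG R n).
Local Open Scope sesquilinear_scope.

(** Indexing by words of length [d] repeats each monomial as often as its factors can be ordered;
    with these repetitions the kernel is exactly a [d]-th power. *)
Definition monom_fun (e : {ffun 'I_d -> 'I_(n * n)}) (x : U) : C :=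
  \prod_t mxvec (umx x) 0 (e t).

Definition entry_fun
    (p : {l : intpart d n & ('I_(udim (pi l)) * 'I_(udim (pi l)))%type})
    (x : U) : C :=
  rep_mx (pi (tag p)) x (tagged p).1 (tagged p).2.

Lemma sum_conj_mul (k : nat) (A B : 'M[C]_k) :
  \sum_(p : 'I_k * 'I_k) (A p.1 p.2)^* * B p.1 p.2 = \tr (A^t* *m B).
Proof.
rewrite /mxtrace -(pair_big xpredT xpredT (fun i j => (A i j)^* * B i j)) /=.
rewrite exchange_big; apply: eq_bigr => j _; rewrite mxE.
by apply: eq_bigr => i _; rewrite !mxE.
Qed.

(** The sum over words is the expanded product of [d] copies of the sum over single entries, and
    that sum is the trace of [x^-1 * y]. *)
Lemma monom_fun_kernel (x y : U) :
  \sum_e (monom_fun e x)^* * monom_fun e y = \tr (umx (x^-1 * y)%g) ^+ d.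
Proof.
rewrite -[umx _]/((umx x)^t* *m umx y) -sum_conj_mul.
rewrite -[d in RHS]card_ord -prodr_const.
transitivity (\prod_(t < d) \sum_q (mxvec (umx x) 0 q)^* * mxvec (umx y) 0 q).
  rewrite bigA_distr_bigA; apply: eq_bigr => e _.
  by rewrite /monom_fun rmorph_prod -big_split.
apply: eq_bigr => t _; rewrite (reindex _ (curry_mxvec_bij n n)).
by apply: eq_bigr => -[i j] _; rewrite !mxvecE.
Qed.

(** The expansion of the power sum into Schur polynomials is evaluated at the eigenvalues of
    [x^-1 * y]. Each Schur polynomial becomes the trace of [pi_l(x)^* pi_l(y)], a sum over
    entries. *)
Lemma entry_fun_kernel :
  exists2 m : intpart d n -> nat, (forall l, (0 < m l)%N) &
  forall x y : U,
    \sum_p (m (tag p))%:R * ((entry_fun p x)^* * entry_fun p y) =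
    \tr (umx (x^-1 * y)%g) ^+ d.
Proof.
have [m m_gt0 mE] := exp_sum_schur C d n; exists m => // x y.
have [t tE] := is_eigs_exists (umx (x^-1 * y)%g).
rewrite (is_eigs_trace tE).
have := congr1 (meval t) mE; rewrite rmorphXn !raddf_sum /=.
under eq_bigr do rewrite mevalXU; move=> ->.
rewrite -(sig_big_dep (fun=> true) (fun _ _ => true) (fun l q => (m l)%:R *
  ((rep_mx (pi l) x q.1 q.2)^* * rep_mx (pi l) y q.1 q.2))) /=.
apply: eq_bigr => l _; rewrite -mulr_sumr sum_conj_mul mevalMn.
by rewrite -((pi_schur l).2 _ _ tE) rep_mxM rep_mxV mulr_natl.
Qed.

(** The weights are positive on both families, so [same_kernel_span] applies in this direction and,
    in [monom_fun_entry], in the other. *)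
Lemma entry_fun_monom p :
  exists v, forall x : U, entry_fun p x = \sum_e v e * monom_fun e x.
Proof.
have [m m_gt0 mE] := entry_fun_kernel.
apply: (@same_kernel_span _ _ _ _ entry_fun monom_fun
  (fun p => (m (tag p))%:R) (fun=> 1)) => [q|x y].
  by rewrite ltr0n.
by rewrite mE -monom_fun_kernel; apply: eq_bigr => e _; rewrite mul1r.
Qed.

Lemma monom_fun_entry e :
  exists v, forall x : U, monom_fun e x = \sum_p v p * entry_fun p x.
Proof.
have [m m_gt0 mE] := entry_fun_kernel.
apply: (@same_kernel_span _ _ _ _ monom_fun entry_fun
  (fun=> 1) (fun p => (m (tag p))%:R)) => [q|x y]; first exact: ltr01.
by rewrite mE -monom_fun_kernel; apply: eq_bigr => e' _; rewrite mul1r.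
Qed.

Lemma hom_poly_spaceP (f : U -> C) :
  hom_poly_space d f <->
  exists v, forall x, f x = \sum_e v e * monom_fun e x.
Proof.
split=> [[p /dhomogP pd ->]|[v vE]].
  (* The word of a monomial lists each variable as often as its exponent says. *)
  have monE (m : 'X_{1..n * n}) : mdeg m = d ->
      exists e, forall w : 'I_(n * n) -> C,
      \prod_i w i ^+ m i = \prod_(t < d) w (e t).
    move=> md; have /eqP sz : size (m2s m) = d by rewrite size_m2s.
    exists (tnth (Tuple sz)) => w.
    have -> : \prod_(t < d) w (tnth (Tuple sz) t) = \prod_(i <- m2s m) w i.
      by rewrite -[m2s m]/(val (Tuple sz)) big_tuple.
    rewrite /m2s big_flatten big_map big_enum /=; apply: eq_bigr => i _.
    by rewrite big_nseq -Monoid.iteropE.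
  suff sumE (s : seq 'X_{1..n * n}) : {in s, forall m, mdeg m = d} ->
      exists v, forall x : U, \sum_(m <- s) p@_m *
        \prod_i mxvec (umx x) 0 i ^+ m i = \sum_e v e * monom_fun e x.
    by have [v vE] := sumE _ pd; exists v => x; rewrite mevalE vE.
  elim: s => [_|m s IH sd].
    by exists (fun=> 0) => x; rewrite big_nil big1 // => e _; rewrite mul0r.
  have [v vE] : exists v, forall x : U, \sum_(m <- s) p@_m *
      \prod_i mxvec (umx x) 0 i ^+ m i = \sum_e v e * monom_fun e x.
    by apply: IH => m' m's; apply: sd; rewrite inE m's orbT.
  have [e eE] := monE m (sd m (mem_head _ _)).
  exists (fun e' => (if e' == [ffun t => e t] then p@_m else 0) + v e') => x.
  rewrite big_cons vE; under [RHS]eq_bigr do rewrite mulrDl.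
  rewrite big_split; congr (_ + _); rewrite (bigD1 [ffun t => e t]) //= eqxx.
  rewrite [X in _ + X]big1 ?addr0 => [|e' /negbTE ->]; last by rewrite mul0r.
  by rewrite eE; congr (_ * _); apply: eq_bigr => t _; rewrite ffunE.
exists (\sum_e v e *: \prod_t 'X_(e t)).
  apply: rpred_sum => e _; apply: rpredZ.
  have h (r : seq 'I_d) :
      \prod_(t <- r) ('X_(e t) : {mpoly C[n * n]}) \is (size r).-homog.
    elim: r => [|t r IH]; first by rewrite big_nil dhomog1.
    rewrite big_cons /= -add1n; apply: dhomogM => //.
    by rewrite dhomogX /= mdeg1.
  by have := h (enum 'I_d); rewrite big_enum size_enum_ord.
apply/funext => x; rewrite vE raddf_sum; apply: eq_bigr => e _ /=.
rewrite mevalZ rmorph_prod; congr (_ * _); apply: eq_bigr => t _.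
by rewrite /= mevalXU.
Qed.

End Kernel.

(** * External tensor products and the biregular action *)

(* For [w] in an invariant subspace [W] and a projection [p] with kernel [W],
   [p (rho g *m w) = 0] is a family of linear relations between the entries
   [rho g i j], with coefficients [p (delta_mx i 0) r 0 * w j 0]. *)
Lemma irreducible_free_coefs (K : fieldType) (G : Type) (k : nat)
    (rho : G -> 'M[K]_k) : (0 < k)%N ->
  (forall A : 'I_k -> 'I_k -> K,
     (forall g, \sum_i \sum_j A i j * rho g i j = 0) ->
     forall i j, A i j = 0) ->
  irreducible_rep rho.
Proof.
move=> k_gt0 free; split=> // W Wrho.
have [->|W0] := eqVneq W 0%VS; [by left|right].
have w0 : vpick W != 0 by rewrite vpick0.
pose p : 'End('cV[K]_k) := (\1 - projv W)%VF.
have pE v : p v = v - projv W v by rewrite !lfunE /= !lfunE.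
have p_coord v r : p v r 0 = \sum_i v i 0 * p (delta_mx i 0) r 0.
  rewrite [v in LHS]matrix_sum_delta linear_sum summxE; apply: eq_bigr => i _.
  by rewrite big_ord1 linearZ mxE.
have p0 i r : p (delta_mx i 0) r 0 = 0.
  have [j wj] : exists j, vpick W j 0 != 0.
    apply/existsP; apply: contraNT w0 => /existsPn w0.
    by apply/eqP/colP => j; rewrite mxE; apply/eqP/negPn/w0.
  apply: (mulIf wj); rewrite mul0r.
  apply: (free (fun i j => p (delta_mx i 0) r 0 * vpick W j 0)) => g.
  have gW : p (rho g *m vpick W) = 0.
    by rewrite pE projv_id ?subrr // Wrho // memv_pick.
  have := p_coord (rho g *m vpick W) r; rewrite gW mxE => h; rewrite [RHS]h.
  apply: eq_bigr => i' _; rewrite mxE mulr_suml.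
  by apply: eq_bigr => j' _; ring.
apply/eqP; rewrite eqEsubv subvf; apply/subvP => v _.
have /subr0_eq -> : v - projv W v = 0; last exact: memv_proj.
rewrite -pE; apply/colP => r; rewrite p_coord mxE big1 // => i _.
by rewrite p0 mulr0.
Qed.

Definition tens_col (K : Type) (k l : nat) (f : 'I_k * 'I_l -> K) :
    'cV[K]_(k * l) :=
  \col_p f (mxtens_unindex p).

Lemma tens_colE (K : Type) (k l : nat) (f : 'I_k * 'I_l -> K) p :
  tens_col f (mxtens_index p) 0 = f p.
Proof. by rewrite mxE mxtens_indexK. Qed.

Section Biregular.
Variables (R : realType) (n : nat).
Local Notation C := R[i].
Local Notation U := (unitaryG R n).
Local Open Scope sesquilinear_scope.

Lemma contragredientE (rho : unitary_rep R n) (g : U) i j :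
  contragredient (rep_mx rho) g i j = (rep_mx rho g i j)^*.
Proof. by rewrite /contragredient rep_mxV !mxE. Qed.

(** The coefficient for [u] and [v] has the rank-one array of products of [v i] with the conjugate
    of [u j]. Standard basis vectors give the elementary arrays, which span all arrays. *)
Lemma coeff_space_contragredient (rho : unitary_rep R n) :
  coeff_space (contragredient (rep_mx rho)) = range (@rep_coef R n rho).
Proof.
have gen (u v : 'cV[C]_(udim rho)) :
    (fun x => Cdot v (contragredient (rep_mx rho) x *m u)) =
    rep_coef (tens_col (fun p => v p.1 0 * (u p.2 0)^*)).
  apply/funext => x; apply: eq_bigr => i _; rewrite mxE rmorph_sum mulr_sumr.
  apply: eq_bigr => j _; rewrite rmorphM /= contragredientE conjCK.
  by rewrite tens_colE /=; ring.
rewrite eqEsubset; split=> f.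
  move=> [m [a [e [eE ->]]]].
  have eE' i : exists v : 'cV[C]_(udim rho * udim rho), e i = rep_coef v.
    by have [u [w ->]] := eE i; rewrite gen; eexists.
  have [v vE] := boolp.choice eE'.
  exists (\sum_i a i *: v i) => //; rewrite linear_sum; apply: eq_bigr => i _.
  by rewrite linearZ vE.
move=> [v _ <-].
exists (udim rho * udim rho)%N, (fun p => v p 0),
  (fun p => rep_coef (delta_mx p 0)); split.
  move=> p; case: p / (mxtens_indexP p) => i j.
  exists (delta_mx j 0), (delta_mx i 0).
  rewrite gen; congr rep_coef; apply/colP => q.
  case: q / (mxtens_indexP q) => i' j'; rewrite tens_colE !mxE !eqxx !andbT.
  by rewrite conjC_nat -natrM mulnb (inj_eq (can_inj (@mxtens_indexK _ _))).
rewrite [v in LHS]matrix_sum_delta linear_sum; apply: eq_bigr => p _.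
by rewrite big_ord1 linearZ.
Qed.

(** Expand [rho(g^-1 x h)] as [rho(g)^* rho(x) rho(h)]: the left factor supplies the conjugate
    entries of [rho(g)], which are those of the contragredient. *)
Lemma rep_coef_biregular (rho : unitary_rep R n) (gh : U * U) v :
  rep_coef (box_rep (contragredient (rep_mx rho)) (rep_mx rho) gh *m v) =
  biregular gh (rep_coef v).
Proof.
case: gh => g h; apply/funext => x; rewrite /biregular /rep_coef /=.
rewrite !rep_mxM rep_mxV.
transitivity (\sum_i \sum_a \sum_j \sum_b
  (rep_mx rho g i j)^* * rep_mx rho h a b * v (mxtens_index (j, b)) 0 *
  rep_mx rho x i a).
  apply: eq_bigr => i _; apply: eq_bigr => a _.
  rewrite mxE sum_tens_index mulr_suml; apply: eq_bigr => j _.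
  rewrite mulr_suml; apply: eq_bigr => b _.
  by rewrite tensmxE contragredientE.
rewrite pair_big /=; under eq_bigr do rewrite pair_big /=.
rewrite exchange_big /= [RHS]pair_big; apply: eq_bigr => -[j b] _ /=.
rewrite mxE mulr_sumr -(pair_big xpredT xpredT (fun i a =>
  (rep_mx rho g i j)^* * rep_mx rho h a b * v (mxtens_index (j, b)) 0 *
  rep_mx rho x i a)) /= exchange_big.
apply: eq_bigr => a _; rewrite mxE mulr_suml mulr_sumr; apply: eq_bigr => i _.
by rewrite !mxE; ring.
Qed.

Lemma box_rep_trace (rho : unitary_rep R n) (g h : U) :
  \tr (box_rep (contragredient (rep_mx rho)) (rep_mx rho) (g, h)) =
  (\tr (rep_mx rho g))^* * \tr (rep_mx rho h).
Proof.
rewrite /mxtrace rmorph_sum mulr_suml sum_tens_index; apply: eq_bigr => i _.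
rewrite mulr_sumr; apply: eq_bigr => a _.
by rewrite tensmxE contragredientE.
Qed.

Variable mu : probability (borelU R n) R.
Hypothesis mu_haar : is_haar mu.

Lemma rep_coefs_free (rho : unitary_rep R n) : irreducible_rep (rep_mx rho) ->
  forall A : 'I_(udim rho) -> 'I_(udim rho) -> C,
  (forall g, \sum_i \sum_j A i j * rep_mx rho g i j = 0) ->
  forall i j, A i j = 0.
Proof.
move=> irho A A0 i j.
pose v := tens_col (fun p => A p.1 p.2).
have : v = 0.
  apply: (rep_coef_inj mu_haar irho); rewrite linear0; apply/funext => x.
  rewrite -[RHS](A0 x); apply: eq_bigr => i' _; apply: eq_bigr => j' _.
  by rewrite tens_colE.
by move/colP/(_ (mxtens_index (i, j))); rewrite tens_colE mxE.
Qed.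

(** The entries are products of a conjugate entry at [g] and an entry at [h]. Independence in [h]
    for fixed [g], then independence in [g], makes them linearly independent. *)
Lemma box_rep_irreducible (rho : unitary_rep R n) :
  irreducible_rep (rep_mx rho) ->
  irreducible_rep (box_rep (contragredient (rep_mx rho)) (rep_mx rho)).
Proof.
move=> irho; have k_gt0 := irho.1; apply: irreducible_free_coefs.
  by rewrite muln_gt0 k_gt0.
move=> A A0 p q.
case: p / (mxtens_indexP p) => i a; case: q / (mxtens_indexP q) => j b.
pose B g a b := \sum_i \sum_j A (mxtens_index (i, a)) (mxtens_index (j, b)) *
  (rep_mx rho g i j)^*.
have B0 g : B g a b = 0.
  apply: (rep_coefs_free irho (A := B g)) => h.
  rewrite -[RHS](A0 (g, h)) [RHS]sum_tens_index [RHS]exchange_big.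
  apply: eq_bigr => a' _.
  under [RHS]eq_bigr do rewrite sum_tens_index exchange_big.
  rewrite [RHS]exchange_big; apply: eq_bigr => b' _ /=.
  rewrite mulr_suml; apply: eq_bigr => i' _.
  rewrite mulr_suml; apply: eq_bigr => j' _.
  by rewrite tensmxE contragredientE /=; ring.
(* Conjugation turns the relation between conjugate entries into one between entries of [rho]. *)
apply/eqP; rewrite -conjC_eq0; apply/eqP.
apply: (rep_coefs_free irho (A := fun i j =>
  (A (mxtens_index (i, a)) (mxtens_index (j, b)))^*)) => g.
transitivity ((B g a b)^*); last by rewrite B0 conjC0.
rewrite /B rmorph_sum; apply: eq_bigr => i' _ /=.
rewrite rmorph_sum; apply: eq_bigr => j' _ /=.
by rewrite rmorphM /= conjCK.
Qed.

(** At [(1, g)] the trace is the dimension times the character, and at [(1, 1)] it is the squared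
    dimension; so the dimensions agree and cancel. *)
Lemma box_rep_equiv (rho sigma : unitary_rep R n) :
  irreducible_rep (rep_mx rho) ->
  equiv_rep (box_rep (contragredient (rep_mx rho)) (rep_mx rho))
    (box_rep (contragredient (rep_mx sigma)) (rep_mx sigma)) ->
  forall g, \tr (rep_mx rho g) = \tr (rep_mx sigma g).
Proof.
move=> [k_gt0 _] /equiv_rep_trace trE g.
have := trE (1%g, g); rewrite !box_rep_trace !rep_mx1 !mxtrace1 !conjC_nat.
have := trE (1%g, 1%g); rewrite !box_rep_trace !rep_mx1 !mxtrace1 !conjC_nat.
rewrite -!natrM => /eqP; rewrite eqr_nat !mulnn eqn_exp2r // => /eqP kE.
have -> : (udim sigma)%:R = (udim rho)%:R :> C by rewrite kE.
by apply: mulfI; rewrite pnatr_eq0 -lt0n.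
Qed.

End Biregular.

(** * The orthogonal and biregular decompositions *)

Lemma L2dot_suml (R : realType) (n : nat) (mu : probability (borelU R n) R)
    (I : finType) (f : I -> unitaryG R n -> R[i]) (h : unitaryG R n -> R[i]) :
  (forall i, bcontC (f i)) -> bcontC h ->
  L2dot mu (\sum_i f i) h = \sum_i L2dot mu (f i) h.
Proof.
move=> nf nh.
transitivity (\sum_i 1 * L2dot mu (f i) h); last first.
  by apply: eq_bigr => i _; rewrite mul1r.
rewrite /L2dot -(@Cintegral_sum _ _ mu _ _ xpredT (fun=> 1)
  (fun i x => f i x * (h x)^*)) => [|i _]; last first.
  by apply: bcontCM => //; exact: bcontC_conj.
congr Cintegral; apply/funext => x; rewrite fct_sumE mulr_suml.
by apply: eq_bigr => i _; rewrite mul1r.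
Qed.

Lemma bcontC_rep_coef (R : realType) (n : nat) (rho : unitary_rep R n) v :
  bcontC (@rep_coef R n rho v).
Proof.
apply: bcontC_sum => i _; apply: bcontC_sum => a _.
by apply: bcontCM; [exact: bcontC_cst|exact: bcontC_entry].
Qed.

Lemma sum_entry_fun (R : realType) (d n : nat)
    (pi : intpart d n -> unitary_rep R n) u (x : unitaryG R n) :
  \sum_p u p * entry_fun p x =
  \sum_l rep_coef (tens_col (fun q => u (existT
    (fun l => ('I_(udim (pi l)) * 'I_(udim (pi l)))%type) l q))) x.
Proof.
transitivity (\sum_l \sum_q u (existT
    (fun l => ('I_(udim (pi l)) * 'I_(udim (pi l)))%type) l q) *
    rep_mx (pi l) x q.1 q.2).
  by rewrite sig_big_dep; apply: eq_bigr => -[l q].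
apply: eq_bigr => l _; rewrite /rep_coef pair_big.
by apply: eq_bigr => -[i j] _; rewrite tens_colE.
Qed.

Lemma hom_poly_space_sum (R : realType) (d n : nat)
    (pi : intpart d n -> unitary_rep R n) (f : unitaryG R n -> R[i]) :
  (forall l : intpart d n, is_schur_rep (parts l) (pi l)) ->
  hom_poly_space d f <->
  exists v : forall l, 'cV[R[i]]_(udim (pi l) * udim (pi l)),
    f = \sum_l rep_coef (v l).
Proof.
move=> pi_schur; rewrite hom_poly_spaceP; split=> [[v vE]|[v ->]].
  have [w wE] := boolp.choice (monom_fun_entry pi_schur).
  exists (fun l => tens_col (fun q => \sum_e v e * w e (existT
    (fun l => ('I_(udim (pi l)) * 'I_(udim (pi l)))%type) l q))).
  apply/funext => x; rewrite vE fct_sumE.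
  rewrite -(sum_entry_fun (fun p => \sum_e v e * w e p)).
  under [RHS]eq_bigr do rewrite mulr_suml.
  rewrite exchange_big; apply: eq_bigr => e _ /=.
  by rewrite wE mulr_sumr; apply: eq_bigr => p _; rewrite mulrA.
have [w wE] := boolp.choice (entry_fun_monom pi_schur).
pose u (p : {l : intpart d n & ('I_(udim (pi l)) * 'I_(udim (pi l)))%type}) :=
  v (tag p) (mxtens_index (tagged p)) 0.
exists (fun e => \sum_p u p * w p e) => x.
transitivity (\sum_p u p * entry_fun p x).
  rewrite sum_entry_fun fct_sumE; apply: eq_bigr => l _; congr (rep_coef _ x).
  apply/colP => q; case: q / (mxtens_indexP q) => i j.
  by rewrite tens_colE.
under [RHS]eq_bigr do rewrite mulr_suml.
rewrite exchange_big; apply: eq_bigr => p _ /=.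
by rewrite wE mulr_sumr; apply: eq_bigr => e _; rewrite mulrA.
Qed.

Theorem theorem2p20 (R : realType) (d n : nat)
    (mu : probability (borelU R n) R) (mu_haar : is_haar mu)
    (pi : intpart d n -> unitary_rep R n)
    (pi_schur : forall l : intpart d n, is_schur_rep (parts l) (pi l)) :
  [/\ direct_sum (@hom_poly_space R n d)
        (fun l : intpart d n => coeff_space (contragredient (rep_mx (pi l)))),
      forall l m : intpart d n, l != m ->
        forall f h : unitaryG R n -> R[i],
          coeff_space (contragredient (rep_mx (pi l))) f ->
          coeff_space (contragredient (rep_mx (pi m))) h ->
          L2dot mu f h = 0 &
      multfree_sum (@biregular R n) (@hom_poly_space R n d)
        (fun l : intpart d n =>
           box_rep (contragredient (rep_mx (pi l))) (rep_mx (pi l)))].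
Proof.
have irr l : irreducible_rep (rep_mx (pi l)) := (pi_schur l).1.
have inequiv l m : l != m -> ~ equiv_rep (rep_mx (pi l)) (rep_mx (pi m)).
  move=> /eqP lm /equiv_rep_trace tr_lm; apply: lm.
  exact: schur_rep_inj (pi_schur l) (pi_schur m) tr_lm.
have ortho l m v w : l != m ->
    L2dot mu (@rep_coef R n (pi l) v) (@rep_coef R n (pi m) w) = 0.
  move=> lm; rewrite L2dot_rep_coef; do 4![apply: big1 => ? _].
  by rewrite coef_dot_inequiv ?mulr0 //; exact: inequiv.
have dsum : direct_sum (@hom_poly_space R n d)
    (fun l : intpart d n => coeff_space (contragredient (rep_mx (pi l)))).
  have coefP e :
      (forall l, coeff_space (contragredient (rep_mx (pi l))) (e l)) ->
      exists v : forall l, 'cV[R[i]]_(udim (pi l) * udim (pi l)),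
        e = fun l => rep_coef (v l).
    (* The type of the array depends on [l], so one is chosen for each [l] separately. *)
    move=> eE; have vP l : {v | e l = @rep_coef R n (pi l) v}.
      apply: cid; have := eE l; rewrite coeff_space_contragredient.
      by move=> [v _ <-]; exists v.
    exists (fun l => sval (vP l)); apply/funext => l.
    by rewrite -(svalP (vP l)).
  split=> [f|_ /coefP[v ->] v0 m].
    rewrite (hom_poly_space_sum f pi_schur); split=> [[v ->]|].
      exists (fun l => rep_coef (v l)); split=> // l.
      by rewrite coeff_space_contragredient; exists (v l).
    by move=> [_ [/coefP[v ->] ->]]; exists v.
  (* Paired with its term [m], the vanishing sum leaves, by orthogonality, only the squared norm of
     that term. *)
  suff -> : v m = 0 by rewrite linear0.
  apply: (L2dot_rep_coef_eq0 mu_haar (irr m)).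
  transitivity (L2dot mu (\sum_l rep_coef (v l)) (rep_coef (v m))).
    rewrite L2dot_suml; try by move=> *; exact: bcontC_rep_coef.
    by rewrite (bigD1 m) //= big1 ?addr0 // => l; exact: ortho.
  rewrite v0 /L2dot -[RHS](Cintegral_cst mu).
  by congr Cintegral; apply/funext => x; rewrite mul0r.
split=> //.
  move=> l m lm f h; rewrite !coeff_space_contragredient.
  by move=> [v _ <-] [w _ <-]; exact: ortho.
exists (fun l => coeff_space (contragredient (rep_mx (pi l)))); split=> //.
- move=> l; exact: box_rep_irreducible mu_haar _ (irr l).
(* Acting on arrays of coefficients, the tensor product is carried by [rep_coef] to the biregular
   action on the summand. *)
- move=> l; exists (@rep_coef R n (pi l)); split.
  + exact: (rep_coef_inj mu_haar (irr l)).
  + by rewrite coeff_space_contragredient.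
  + exact: rep_coef_biregular.
- move=> l m lm /(box_rep_equiv (irr l)) tr_lm.
  by move/eqP: lm; apply; exact: schur_rep_inj (pi_schur l) (pi_schur m) tr_lm.
Qed.
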